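(* Let $k$ be an algebraically closed field of characteristic zero, let $N\subset SL_2(k)$ be the normalizer of the one-dimensional torus, let $X=SL_2(k)/N$, and let $R=\mathcal{O}(X)$, identified with the subalgebra of $k[x_0,x_1,x_2]=k[X_0,X_1,X_2]/(2X_0X_2-X_1^2-1)$ generated by the quadratic monomials $x_ix_j$, $0\le i\le j\le 2$. Let $R[T]\cong_k R^{[1]}$ and define $$F=15(x_0^2)T-3(x_0x_1)(x_2^2)-2(x_1x_2)\in R[T]\quad\text{and}\quad \tilde{R}=R[T]/(F).$$ Then: (a) $R^{[1]}\cong_k\tilde{R}^{[1]}$; (b) $R\not\cong_k\tilde{R}$.
   Context: For a ring $S$, $S^{[1]}$ denotes the polynomial ring in one variable over $S$; here $T$ is an indeterminate over $R$. $x_i$ denotes the image of $X_i$. $\cong_k$ denotes isomorphism of $k$-algebras. *)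

(* Defs.v *)
From HB Require Import structures.
From mathcomp Require Import all_boot all_algebra generic_quotient ring_quotient.
From mathcomp Require Import boolp classical_sets functions.
From mathcomp Require Import mpoly ring.

Set Implicit Arguments.
Unset Strict Implicit.
Unset Printing Implicit Defensive.

Import GRing.Theory.
Local Open Scope ring_scope.
Local Open Scope quotient_scope.

Definition alg_isomorphic (k : nzRingType) (A B : algType k) : Prop :=
  exists f : {lrmorphism A -> B}, bijective f.

(* A^[1] as a k-algebra.  [{poly A}] itself carries an A-algebra structure,
   hence the alias. *)
Section PolyAlgebra.
Variables (k : comNzRingType) (A : comAlgType k).

Definition polyalg := {poly A}.
HB.instance Definition _ := GRing.ComNzRing.on polyalg.

Definition polyalg_scale (c : k) (p : polyalg) : polyalg := (c%:A)%:P * p.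

Fact polyalg_scaleA c d p :
  polyalg_scale c (polyalg_scale d p) = polyalg_scale (c * d) p.
Proof. by rewrite /polyalg_scale mulrA -polyCM -scalerAl mul1r scalerA. Qed.
Fact polyalg_scale1 : left_id 1 polyalg_scale.
Proof. by move=> p; rewrite /polyalg_scale scale1r mul1r. Qed.
Fact polyalg_scaleDr : right_distributive polyalg_scale +%R.
Proof. by move=> c p q; rewrite /polyalg_scale mulrDr. Qed.
Fact polyalg_scaleDl p : {morph polyalg_scale^~ p : c d / c + d}.
Proof. by move=> c d; rewrite /polyalg_scale scalerDl polyCD mulrDl. Qed.
HB.instance Definition _ := GRing.Zmodule_isLmodule.Build k polyalg
  polyalg_scaleA polyalg_scale1 polyalg_scaleDr polyalg_scaleDl.

Fact polyalg_scaleAl (c : k) (p q : polyalg) : c *: (p * q) = (c *: p) * q.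
Proof. exact: mulrA. Qed.
HB.instance Definition _ := GRing.Lmodule_isLalgebra.Build k polyalg
  polyalg_scaleAl.
HB.instance Definition _ := GRing.Lalgebra_isComAlgebra.Build k polyalg.
End PolyAlgebra.

(* The principal ideal (a); [ha] ensures that the quotient is a nonzero ring,
   as required by [{poly _}]. *)
Section PrincipalIdeal.
Variables (A : comNzRingType) (a : A) (ha : forall b, b * a != 1).

Definition principal_ideal of (forall b, b * a != 1) : A -> bool :=
  fun x => `[< exists b, x = b * a >].

Fact principal_ideal_closed : idealr_closed (principal_ideal ha).
Proof.
split; first by apply/asboolP; exists 0; rewrite mul0r.
  by apply/asboolPn => -[b] /esym/eqP; apply/negP.
move=> c x y /asboolP[b ->] /asboolP[d ->]; apply/asboolP.
by exists (c * b + d); rewrite mulrDl mulrA.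
Qed.
HB.instance Definition _ := isIdealr.Build A (principal_ideal ha)
  principal_ideal_closed.
End PrincipalIdeal.

Section QuotientAlgebra.
Variables (k : comNzRingType) (A : comAlgType k) (I : idealr A).

Definition quotalg := {ideal_quot I}.
HB.instance Definition _ := GRing.ComNzRing.on quotalg.

Definition quotalg_pi : A -> quotalg := \pi_({ideal_quot I}).
HB.instance Definition _ := GRing.RMorphism.copy quotalg_pi \pi_({ideal_quot I}).

Definition quotalg_scale (c : k) (x : quotalg) : quotalg := quotalg_pi c%:A * x.

Fact quotalg_scaleA c d x :
  quotalg_scale c (quotalg_scale d x) = quotalg_scale (c * d) x.
Proof. by rewrite /quotalg_scale mulrA -rmorphM -scalerAl mul1r scalerA. Qed.
Fact quotalg_scale1 : left_id 1 quotalg_scale.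
Proof. by move=> x; rewrite /quotalg_scale scale1r rmorph1 mul1r. Qed.
Fact quotalg_scaleDr : right_distributive quotalg_scale +%R.
Proof. by move=> c x y; rewrite /quotalg_scale mulrDr. Qed.
Fact quotalg_scaleDl x : {morph quotalg_scale^~ x : c d / c + d}.
Proof. by move=> c d; rewrite /quotalg_scale scalerDl rmorphD mulrDl. Qed.
HB.instance Definition _ := GRing.Zmodule_isLmodule.Build k quotalg
  quotalg_scaleA quotalg_scale1 quotalg_scaleDr quotalg_scaleDl.

Fact quotalg_scaleAl (c : k) (x y : quotalg) : c *: (x * y) = (c *: x) * y.
Proof. exact: mulrA. Qed.
HB.instance Definition _ := GRing.Lmodule_isLalgebra.Build k quotalg
  quotalg_scaleAl.
HB.instance Definition _ := GRing.Lalgebra_isComAlgebra.Build k quotalg.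

Fact quotalg_pi_is_scalable : scalable quotalg_pi.
Proof.
by move=> c x; rewrite -[c *: x]mul1r -scalerAr scalerAl rmorphM.
Qed.
HB.instance Definition _ := GRing.isScalable.Build k A quotalg *:%R quotalg_pi
  quotalg_pi_is_scalable.

Variables (B : nzRingType) (f : {rmorphism A -> B}).
Hypothesis f0 : forall a, a \in I -> f a = 0.

Definition quotalg_lift of (forall a, a \in I -> f a = 0) : quotalg -> B :=
  fun z => f (repr (z : {ideal_quot I})).

Fact quotalg_liftE a : quotalg_lift f0 (quotalg_pi a) = f a.
Proof.
apply/subr0_eq; rewrite -rmorphB; apply: f0.
by rewrite Quotient.idealrBE; apply/eqP; rewrite reprK.
Qed.
Fact quotalg_piK z : exists a, z = quotalg_pi a.
Proof. by exists (repr (z : {ideal_quot I})); rewrite [RHS]reprK. Qed.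

Fact quotalg_lift_zmod : zmod_morphism (quotalg_lift f0).
Proof.
move=> u v; have [[a ->] [b ->]] := (quotalg_piK u, quotalg_piK v).
by rewrite -rmorphB !quotalg_liftE rmorphB.
Qed.
Fact quotalg_lift_monoid : monoid_morphism (quotalg_lift f0).
Proof.
split=> [|u v]; first by rewrite -(rmorph1 quotalg_pi) quotalg_liftE rmorph1.
have [[a ->] [b ->]] := (quotalg_piK u, quotalg_piK v).
by rewrite -rmorphM !quotalg_liftE rmorphM.
Qed.
HB.instance Definition _ := GRing.isZmodMorphism.Build quotalg B
  (quotalg_lift f0) quotalg_lift_zmod.
HB.instance Definition _ := GRing.isMonoidMorphism.Build quotalg B
  (quotalg_lift f0) quotalg_lift_monoid.
End QuotientAlgebra.

(* k[x_0, x_1, x_2] = k[X_0, X_1, X_2] / (2 X_0 X_2 - X_1^2 - 1) *)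
Section Quadric.
Variable k : closedFieldType.

Definition i0 : 'I_3 := @Ordinal 3 0 isT.
Definition i1 : 'I_3 := @Ordinal 3 1 isT.
Definition i2 : 'I_3 := @Ordinal 3 2 isT.

Definition quadric_eq : {mpoly k[3]} := 2 * 'X_i0 * 'X_i2 - 'X_i1 ^+ 2 - 1.

(* The point (0, i, 0) of the quadric, where i^2 = -1. *)
Definition quadric_pt (i : k) : 'I_3 -> k := fun j => if j == i1 then i else 0.

Fact ex_sqrtN1 : exists i : k, i ^+ 2 = -1.
Proof.
have [i Hi] := @solve_monicpoly k 2 (fun j => if j == 0%N then -1 else 0) isT.
by exists i; rewrite Hi !big_ord_recl big_ord0 /= expr0 mulr1 mul0r !addr0.
Qed.

Fact quadric_eq_pt i : i ^+ 2 = -1 -> quadric_eq.@[quadric_pt i] = 0.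
Proof.
move=> Hi; rewrite /quadric_eq !mevalB expr2 !mevalM !mevalXU meval1.
by rewrite /quadric_pt /= mulr0 sub0r -expr2 Hi opprK subrr.
Qed.

Fact quadric_eq_nonunit (p : {mpoly k[3]}) : p * quadric_eq != 1.
Proof.
have [i Hi] := ex_sqrtN1; apply/eqP => /(congr1 (meval (quadric_pt i)))/eqP.
by rewrite mevalM quadric_eq_pt // mulr0 meval1 eq_sym oner_eq0.
Qed.

Definition quadric : comAlgType k :=
  quotalg (principal_ideal quadric_eq_nonunit).

Definition xvar (i : 'I_3) : quadric :=
  quotalg_pi (principal_ideal quadric_eq_nonunit) 'X_i.

(* The subalgebra generated by the quadratic monomials. *)
Definition in_quadratic : quadric -> bool := fun z =>
  `[< forall S : {pred quadric}, subalg_closed S ->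
        (forall i j : 'I_3, (i <= j)%N -> xvar i * xvar j \in S) -> z \in S >].

Fact in_quadratic_subalg : subalg_closed in_quadratic.
Proof.
split; first by apply/asboolP => S [].
  move=> c u v /asboolP hu /asboolP hv; apply/asboolP => S hS hx.
  by have [_ + _] := hS; apply; [apply: hu | apply: hv].
move=> u v /asboolP hu /asboolP hv; apply/asboolP => S hS hx.
by have [_ _] := hS; apply; [apply: hu | apply: hv].
Qed.
HB.instance Definition _ := GRing.isSubalgClosed.Build k quadric in_quadratic
  in_quadratic_subalg.

Record quadratic := Quadratic
  { quadratic_val :> quadric; _ : in_quadratic quadratic_val }.
HB.instance Definition _ := [isSub for quadratic_val].
HB.instance Definition _ := [Choice of quadratic by <:].
HB.instance Definition _ :=
  [SubChoice_isSubComNzRing of quadratic by <:].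
HB.instance Definition _ := [SubZmodule_isSubLmodule of quadratic by <:].
HB.instance Definition _ :=
  [SubNzRing_SubLmodule_isSubLalgebra of quadratic by <:].
HB.instance Definition _ := [SubLalgebra_isSubAlgebra of quadratic by <:].


Fact quadratic_monomial_subproof i j : in_quadratic (xvar i * xvar j).
Proof.
apply/asboolP => S _ hx.
by have [/hx //|/ltnW/hx] := leqP i j; rewrite mulrC.
Qed.
Definition xmon (i j : 'I_3) : quadratic :=
  Quadratic (quadratic_monomial_subproof i j).

Definition F : {poly quadratic} :=
  (15 * xmon i0 i0)%:P * 'X - (3 * xmon i0 i1 * xmon i2 i2)%:P - (2 * xmon i1 i2)%:P.

Fact F_nonunit (p : polyalg quadratic) : p * F != 1.
Proof.
have [i Hi] := ex_sqrtN1.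
have pt0 a : a \in principal_ideal quadric_eq_nonunit ->
    meval (quadric_pt i) a = 0.
  by move=> /asboolP[b ->]; rewrite mevalM quadric_eq_pt ?mulr0.
have [ev evxx] : exists ev : {rmorphism quadratic -> k},
    forall j l, ev (xmon j l) = quadric_pt i j * quadric_pt i l.
  exists (quotalg_lift pt0 \o val) => j l.
  have evx m : quotalg_lift pt0 (xvar m) = quadric_pt i m.
    by rewrite quotalg_liftE /= mevalXU.
  by rewrite -[LHS]/(quotalg_lift pt0 (xvar j * xvar l)) rmorphM -!evx.
suff nonunit (q : {poly quadratic}) : q * F != 1.
  exact: nonunit.
have F0 : (map_poly ev F).[0] = 0.
  rewrite /F !rmorphB rmorphM /= map_polyX !map_polyC /=.
  rewrite !hornerE !(rmorphM, rmorph_nat) /= !evxx.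
  by rewrite /quadric_pt /= !(mul0r, mulr0, subr0, oppr0).
apply/eqP => /(congr1 (fun r => (map_poly ev r).[0]))/eqP.
by rewrite rmorphM hornerM F0 mulr0 rmorph1 hornerC eq_sym oner_eq0.
Qed.

Definition Rtilde : comAlgType k := quotalg (principal_ideal F_nonunit).
End Quadric.

Section CoordinateRing.
Variable k : closedFieldType.

Definition SL2 := {g : 'M[k]_2 | \det g == 1}.
HB.instance Definition _ := Choice.on SL2.
Fact SL2_one_subproof : \det (1%:M : 'M[k]_2) == 1.
Proof. by rewrite det1. Qed.
HB.instance Definition _ := isPointed.Build SL2
  (exist (fun g : 'M[k]_2 => \det g == 1) 1%:M SL2_one_subproof).

Definition torus (t : 'M[k]_2) : Prop := is_diag_mx t /\ \det t = 1.

(* As n is invertible, the second condition says that n T n^-1 = T. *)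
Definition torus_normalizer (n : 'M[k]_2) : Prop :=
  \det n = 1 /\ forall t : 'M[k]_2, torus (n *m t *m invmx n) <-> torus t.

Definition SL2fun := SL2 -> k.
HB.instance Definition _ := GRing.ComNzRing.on SL2fun.
HB.instance Definition _ := GRing.Lmodule.copy SL2fun (SL2 -> k^o).
Fact SL2fun_scaleAl (c : k) (f g : SL2fun) : c *: (f * g) = (c *: f) * g.
Proof. by apply/funext => a; exact: mulrA. Qed.
HB.instance Definition _ := GRing.Lmodule_isLalgebra.Build k SL2fun
  SL2fun_scaleAl.
HB.instance Definition _ := GRing.Lalgebra_isComAlgebra.Build k SL2fun.

Definition regular (f : SL2fun) : Prop :=
  exists p : {mpoly k[2 * 2]}, forall g : SL2, f g = p.@[mxvec (val g) 0].

Definition right_invariant (f : SL2fun) : Prop :=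
  forall (g h : SL2) (n : 'M[k]_2),
    torus_normalizer n -> val h = val g *m n -> f h = f g.

Definition in_OX : SL2fun -> bool :=
  fun f => `[< regular f /\ right_invariant f >].

Fact in_OX_subalg : subalg_closed in_OX.
Proof.
split.
- by apply/asboolP; split=> //; exists 1 => g; rewrite meval1.
- move=> c u v /asboolP[[p Hp] iu] /asboolP[[q Hq] iv]; apply/asboolP; split.
    by exists (c *: p + q) => g; rewrite mevalD mevalZ -Hp -Hq.
  by move=> g h n Hn Hgh; congr (c * _ + _); [apply: iu Hgh|apply: iv Hgh].
move=> u v /asboolP[[p Hp] iu] /asboolP[[q Hq] iv]; apply/asboolP; split.
  by exists (p * q) => g; rewrite mevalM -Hp -Hq.
by move=> g h n Hn Hgh; congr (_ * _); [apply: iu Hgh|apply: iv Hgh].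
Qed.
HB.instance Definition _ := GRing.isSubalgClosed.Build k SL2fun in_OX
  in_OX_subalg.

(* O(SL_2 / N): the regular functions on SL_2 that are constant on the left
   cosets of N. *)
Record OX := RegularFun { OX_val :> SL2fun; _ : in_OX OX_val }.
HB.instance Definition _ := [isSub for OX_val].
HB.instance Definition _ := [Choice of OX by <:].
HB.instance Definition _ := [SubChoice_isSubComNzRing of OX by <:].
HB.instance Definition _ := [SubZmodule_isSubLmodule of OX by <:].
HB.instance Definition _ := [SubNzRing_SubLmodule_isSubLalgebra of OX by <:].
HB.instance Definition _ := [SubLalgebra_isSubAlgebra of OX by <:].
End CoordinateRing.

(* The identification of O(SL_2 / N) with the quadratic subalgebra, sending
   x_0, x_1, x_2 to i ab, i (ad + bc), 2i cd, where a, b, c, d are the matrix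
   entries and i^2 = -1. *)
Module QuadraticOX.
Section Identification.
Variable k : closedFieldType.
Hypothesis char0 : [pchar k] =i pred0.

Local Notation a0 := (ord0 : 'I_2).
Local Notation a1 := (ord_max : 'I_2).
Local Notation X := (xvar k).
Local Notation inQ := (@in_quadratic k).

Lemma natk n : (n.+1%:R : k) != 0.
Proof. by have /pcharf0P -> := char0. Qed.

Variable i : k.
Hypothesis ii : i * i = -1.

Lemma l00 : lift (0 : 'I_2) (0 : 'I_1) = ord_max. Proof. exact/val_inj. Qed.
Lemma l10 : lift (ord_max : 'I_2) (0 : 'I_1) = ord0. Proof. exact/val_inj. Qed.
Lemma detE (g : 'M[k]_2) : \det g = g a0 a0 * g a1 a1 - g a0 a1 * g a1 a0.
Proof.
rewrite (expand_det_row _ ord0) !big_ord_recl big_ord0 /cofactor !det_mx11 !mxE.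
by rewrite !l00 !l10 /= expr0 expr1; ring.
Qed.

Lemma mulE (g h : 'M[k]_2) u v :
  (g *m h) u v = g u a0 * h a0 v + g u a1 * h a1 v.
Proof.
rewrite mxE !big_ord_recl big_ord0 addr0.
by rewrite l00.
Qed.

Definition pt (g : 'M[k]_2) : 'I_3 -> k := fun j =>
  if j == i0 then i * (g a0 a0 * g a0 a1)
  else if j == i1 then i * (g a0 a0 * g a1 a1 + g a0 a1 * g a1 a0)
  else 2 * i * (g a1 a0 * g a1 a1).

Definition E (p : {mpoly k[3]}) : SL2fun k := fun g => p.@[pt (val g)].
Fact E_zmod : zmod_morphism E.
Proof. by move=> p q; apply/funext => g; rewrite /E mevalB. Qed.
Fact E_monoid : monoid_morphism E.
Proof.
by split=> [|p q]; apply/funext => g; rewrite /E ?meval1 ?mevalM.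
Qed.
HB.instance Definition _ := GRing.isZmodMorphism.Build _ _ E E_zmod.
HB.instance Definition _ := GRing.isMonoidMorphism.Build _ _ E E_monoid.

Lemma quadric_eqE v : (quadric_eq k).@[v] = 2 * v i0 * v i2 - v i1 * v i1 - 1.
Proof.
rewrite /quadric_eq !mevalB expr2 !mevalM !mevalXU meval1.
by rewrite rmorphMn /= meval1.
Qed.

Lemma E0 p : p \in principal_ideal (@quadric_eq_nonunit k) -> E p = 0.
Proof.
move=> /asboolP[b ->]; apply/funext => g; rewrite /E mevalM quadric_eqE.
have /eqP := valP g; rewrite detE => dg.
rewrite /pt /=.
set a := _ a0 a0 in dg *; set b' := _ a0 a1 in dg *.
set c := _ a1 a0 in dg *; set d := _ a1 a1 in dg *.
suff -> : 2 * (i * (a * b')) * (2 * i * (c * d)) -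
  i * (a * d + b' * c) * (i * (a * d + b' * c)) - 1 = 0 by rewrite mulr0.
have -> : 2 * (i * (a * b')) * (2 * i * (c * d)) -
  i * (a * d + b' * c) * (i * (a * d + b' * c)) - 1 =
  - (i * i) * (a * d - b' * c) ^+ 2 - 1 by ring.
by rewrite ii dg; ring.
Qed.

Definition psi : quadric k -> SL2fun k := quotalg_lift E0.
HB.instance Definition _ := GRing.RMorphism.copy psi (quotalg_lift E0).

Lemma psiE p g :
  psi (quotalg_pi (principal_ideal (@quadric_eq_nonunit k)) p) g = p.@[pt (val g)].
Proof. by rewrite /psi quotalg_liftE. Qed.
Lemma psi_var j g : psi (xvar k j) g = pt (val g) j.
Proof. by rewrite psiE mevalXU. Qed.
Lemma psiK z : exists p, z = quotalg_pi (principal_ideal (@quadric_eq_nonunit k)) p.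
Proof. exact: quotalg_piK. Qed.
Lemma psiZ c z : psi (c *: z) = c *: psi z.
Proof.
have [p ->] := psiK z; rewrite -linearZ; apply/funext => g.
by rewrite psiE mevalZ -psiE.
Qed.

Lemma quadric_ind (S : {pred quadric k}) : subalg_closed S ->
  (forall j, xvar k j \in S) -> forall z, z \in S.
Proof.
move=> SS xS z; have [p ->] := psiK z.
have [S1 SL SM] := SS.
have MS u v : u \in S -> v \in S -> u * v \in S by apply/SM.
have S0 : 0 \in S by rewrite -(addNr (1 : quadric k)) -scaleN1r; apply: SL.
have SD u v : u \in S -> v \in S -> u + v \in S.
  by move=> uS vS; rewrite -[u]scale1r; apply: SL.
have SZ c u : u \in S -> c *: u \in S.
  by move=> uS; rewrite -[_ *: _]addr0; apply: SL.
rewrite [p]mpolyE raddf_sum /=.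
elim/big_rec: _ => // m q _ qS; apply/SD => //.
rewrite linearZ; apply: SZ; rewrite mpolyXE_id rmorph_prod /=.
elim/big_rec: _ => // j q' _ qS'; apply/MS => //.
rewrite rmorphXn /=; elim: (m j) => [|n IHn]; first by rewrite expr0.
by rewrite exprS; apply/MS => //; exact: xS.
Qed.

Definition mk (a b c d : k) : 'M[k]_2 :=
  \matrix_(r, s) (if r == a0 then if s == a0 then a else b
                  else if s == a0 then c else d).
Lemma det_mk (a b c d : k) : \det (mk a b c d) = a * d - b * c.
Proof. by rewrite detE !mxE. Qed.
Definition mkg (a b c d : k) (h : a * d - b * c = 1) : SL2 k.
Proof. by exists (mk a b c d); rewrite det_mk h. Defined.

Lemma mxeq2 (g h : 'M[k]_2) : g a0 a0 = h a0 a0 -> g a0 a1 = h a0 a1 ->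
  g a1 a0 = h a1 a0 -> g a1 a1 = h a1 a1 -> g = h.
Proof.
move=> h1 h2 h3 h4; apply/matrixP => r s.
have two (t : 'I_2) : t = a0 \/ t = a1.
  by case: t => [[|[|//]] ?]; [left|right]; apply/val_inj.
by case: (two r) => ->; case: (two s) => ->.
Qed.

Lemma pt_onto (v0 v1 v2 : k) : 2 * v0 * v2 - v1 * v1 = 1 ->
  exists g : SL2 k, [/\ pt (val g) i0 = v0, pt (val g) i1 = v1 & pt (val g) i2 = v2].
Proof.
move=> hv.
have n2 : (2 : k) != 0 := natk 1.
have n4 : (4 : k) != 0 := natk 3.
have ni : - (i * i) = 1 by rewrite ii opprK.
pose A := - i * v0; pose C := - i * v2 / 2; pose s := - i * v1.
pose D := (s + 1) / 2; pose B := (s - 1) / 2.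
have DB : D - B = 1 by rewrite /D /B; field.
have AC : A * C = D * B.
  have -> : A * C = (i * i) * (2 * v0 * v2) / 4 by rewrite /A /C; field; rewrite n2 n4.
  have -> : D * B = ((i * i) * (v1 * v1) - 1) / 4 by rewrite /D /B /s; field; rewrite n2 n4.
  rewrite ii; have -> : 2 * v0 * v2 = 1 + v1 * v1 by apply/eqP; rewrite -subr_eq hv.
  by congr (_ / _); ring.
have iA : i * A = v0 by rewrite /A mulrA mulrN ni mul1r.
have is' : i * s = v1 by rewrite /s mulrA mulrN ni mul1r.
have iC : 2 * i * C = v2.
  have -> : 2 * i * C = - (i * i) * v2 by rewrite /C; field.
  by rewrite ni mul1r.
have sDB : s = D + B by rewrite /D /B; field.
have [D0|D0] := eqVneq D 0.
  have B1 : B = -1 by rewrite -DB D0; ring.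
  have h : A * (- C) - 1 * (-1) = 1 by rewrite mulrN AC D0; ring.
  exists (mkg h); rewrite /pt /= !mxE /=; split=> //.
  - by rewrite mulr1.
  - by rewrite mulrN AC D0 -is' sDB D0 B1; ring.
  - by rewrite mulN1r opprK.
have h : 1 * D - A * (C / D) = 1 by rewrite mul1r mulrA AC -[RHS]DB; field.
exists (mkg h); rewrite /pt /= !mxE /=; split=> //.
- by rewrite mul1r.
- by rewrite (mulrA A) AC -is' sDB; field.
- by rewrite divfK.
Qed.

Lemma n_cases (n : 'M[k]_2) : torus_normalizer n ->
  n a0 a0 * n a1 a1 - n a0 a1 * n a1 a0 = 1 /\
  ((n a0 a1 = 0 /\ n a1 a0 = 0) \/ (n a0 a0 = 0 /\ n a1 a1 = 0)).
Proof.
case=> dn; rewrite -detE dn => H; split=> //.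
have n2 : (2 : k) != 0 := natk 1.
have n4 : (4 : k) != 0 := natk 3.
have n3 : (3 : k) != 0 := natk 2.
have Ht : torus (mk 2 0 0 (2^-1)).
  split; last by rewrite det_mk; field.
  by apply/is_diag_mxP => r s; rewrite mxE; case: r => [[|[|//]] ?]; case: s => [[|[|//]] ?].
have [/is_diag_mxP dg _] := proj2 (H _) Ht.
set m := mk (n a1 a1) (- n a0 a1) (- n a1 a0) (n a0 a0).
have inv : invmx n = m.
  have nm : n *m m = 1%:M.
    rewrite detE in dn.
    by apply: mxeq2; rewrite !mulE !mxE /= -?dn; ring.
  have un : n \in unitmx by rewrite unitmxE dn unitr1.
  by rewrite -[m](mulKmx un) nm mulmx1.
have e01 : n a0 a0 * n a0 a1 = 0.
  have := dg a0 a1 isT; rewrite inv !mulE !mxE /= => e.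
  apply: (mulfI (x := - (3 / 2))); first by rewrite oppr_eq0 mulf_neq0 // invr_eq0.
  by rewrite mulr0 -e; field.
have e10 : n a1 a0 * n a1 a1 = 0.
  have := dg a1 a0 isT; rewrite inv !mulE !mxE /= => e.
  apply: (mulfI (x := 3 / 2)); first by rewrite mulf_neq0 // invr_eq0.
  by rewrite mulr0 -e; field.
rewrite detE in dn.
have [z|nz] := eqVneq (n a0 a0) 0.
  right; split=> //; apply/eqP; move/eqP: e10; rewrite mulf_eq0 => /orP[/eqP z'|//].
  by move/eqP: dn; rewrite z z' mul0r mulr0 subr0 eq_sym oner_eq0.
left; move/eqP: e01; rewrite mulf_eq0 (negPf nz) /= => /eqP z; split=> //.
apply/eqP; move/eqP: e10; rewrite mulf_eq0 => /orP[//|/eqP z'].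
by move/eqP: dn; rewrite z z' mul0r mulr0 subr0 eq_sym oner_eq0.
Qed.

Lemma pt_n (g n : 'M[k]_2) : torus_normalizer n ->
  (forall j, pt (g *m n) j = pt g j) \/ (forall j, pt (g *m n) j = - pt g j).
Proof.
move=> /n_cases[dn [[z1 z2]|[z1 z2]]]; [left|right] => j;
  rewrite /pt !mulE z1 z2.
  rewrite z1 z2 mul0r subr0 in dn.
  by case: ifP => _; [|case: ifP => _];
    rewrite -[RHS]mulr1 -dn; ring.
rewrite z1 z2 mul0r sub0r in dn.
by case: ifP => _; [|case: ifP => _]; rewrite -[RHS]mulr1 -dn; ring.
Qed.

Lemma psi_regular z : regular (psi z).
Proof.
suff : z \in [pred z | `[< regular (psi z) >] ] by move/asboolP.
apply: quadric_ind.
  split; first by apply/asboolP; exists 1 => g; rewrite rmorph1 meval1.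
    move=> c u v /asboolP[p Hp] /asboolP[q Hq]; apply/asboolP.
    by exists (c *: p + q) => g; rewrite rmorphD /= psiZ mevalD mevalZ -Hp -Hq.
  move=> u v /asboolP[p Hp] /asboolP[q Hq]; apply/asboolP.
  by exists (p * q) => g; rewrite rmorphM mevalM -Hp -Hq.
move=> j; apply/asboolP.
pose X u v : {mpoly k[2 * 2]} := 'X_(mxvec_index u v).
exists (if j == i0 then i *: (X a0 a0 * X a0 a1)
  else if j == i1 then i *: (X a0 a0 * X a1 a1 + X a0 a1 * X a1 a0)
  else (2 * i) *: (X a1 a0 * X a1 a1)) => g.
rewrite psi_var /pt; case: ifP => _; [|case: ifP => _];
by rewrite mevalZ ?mevalD !mevalM !mevalXU !mxvecE.
Qed.

Lemma psi_inv z : in_quadratic z -> right_invariant (psi z).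
Proof.
move=> /asboolP/(_ [pred z | `[< right_invariant (psi z) >] ]) H.
apply/asboolP; apply: H.
  split; first by apply/asboolP => g h n _ _; rewrite rmorph1.
    move=> c u v /asboolP Hu /asboolP Hv; apply/asboolP => g h n Hn gh.
    rewrite rmorphD /= psiZ; congr (c * _ + _); [exact: Hu gh|exact: Hv gh].
  move=> u v /asboolP Hu /asboolP Hv; apply/asboolP => g h n Hn gh.
  by rewrite rmorphM; congr (_ * _); [exact: Hu gh|exact: Hv gh].
move=> j l _; apply/asboolP => g h n Hn gh; rewrite rmorphM.
rewrite -[LHS]/(psi (xvar k j) h * psi (xvar k l) h).
rewrite -[RHS]/(psi (xvar k j) g * psi (xvar k l) g) !psi_var gh.
by case: (pt_n (val g) Hn) => H; rewrite !H // mulrNN.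
Qed.

Lemma poly_inf (D : idomainType) (s : nat -> D) (q : {poly D}) :
  injective s -> (forall n, q.[s n] = 0) -> q = 0.
Proof.
move=> sI q0; apply/eqP/negPn/negP => qn0.
have := @max_poly_roots _ q [seq s n | n <- iota 0 (size q)] qn0.
rewrite size_map size_iota ltnn map_inj_uniq ?iota_uniq // => H.
suff : false by []. apply: H => //.
by apply/allP => _ /mapP[n _ ->]; apply/eqP/q0.
Qed.

Lemma nat_inj : injective (fun n => n%:R : k).
Proof.
move=> m n; wlog mn : m n / (m <= n)%N.
  by move=> H; case/orP: (leq_total m n) => ? e; [exact: H|apply/esym/H].
move=> e; apply/eqP; rewrite eqn_leq mn /= -subn_eq0.
have /pcharf0P <- := char0.
by rewrite natrB // -e subrr.
Qed.

Lemma poly2_inf (q : {poly {poly k}}) :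
  (forall u v : k, q.[u%:P].[v] = 0) -> q = 0.
Proof.
move=> H; apply: (@poly_inf _ (fun n => (n%:R : k)%:P)).
  by move=> m n /polyC_inj/nat_inj.
by move=> n; apply: (poly_inf nat_inj) => m; exact: H.
Qed.

Lemma sqr_ex (c : k) : exists s, s * s = c.
Proof.
have [s Hs] := @solve_monicpoly k 2 (fun j => if j == 0%N then c else 0) isT.
exists s; rewrite -expr2 Hs !big_ord_recl big_ord0 /=.
by rewrite expr0 mulr1 mul0r !addr0.
Qed.

Definition J1 : {rmorphism {poly k} -> quadric k} := horner_alg (X i2).
Lemma J1_comm : commr_rmorph J1 (X i0). Proof. by move=> ?; exact: mulrC. Qed.
Definition J : {rmorphism {poly {poly k}} -> quadric k} := horner_morph J1_comm.

Lemma J1C c : J1 c%:P = c%:A. Proof. exact: horner_algC. Qed.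
Lemma J1X : J1 'X = X i2. Proof. exact: horner_algX. Qed.
Lemma JC p : J p%:P = J1 p. Proof. exact: horner_morphC. Qed.
Lemma JX : J 'X = X i0. Proof. exact: horner_morphX. Qed.

Lemma psiJ1 q (g : SL2 k) : psi (J1 q) g = q.[pt (val g) i2].
Proof.
elim/poly_ind: q => [|q c IH]; first by rewrite !rmorph0 horner0.
rewrite [J1 _]rmorphD [J1 (_ * _)]rmorphM J1C J1X.
rewrite rmorphD rmorphM /= psiZ rmorph1.
by rewrite -[LHS]/(psi (J1 q) g * psi (X i2) g + c * 1) psi_var IH mulr1 !hornerE.
Qed.
Lemma psiJ q (g : SL2 k) : psi (J q) g = q.[(pt (val g) i0)%:P].[pt (val g) i2].
Proof.
elim/poly_ind: q => [|q c IH]; first by rewrite !rmorph0 !horner0.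
rewrite [J _]rmorphD [J (_ * _)]rmorphM JC JX.
rewrite rmorphD rmorphM.
rewrite -[LHS]/(psi (J q) g * psi (X i0) g + psi (J1 c) g).
by rewrite psi_var IH psiJ1 !hornerE.
Qed.

Lemma rel : X i1 * X i1 = J (2 * 'X * ('X)%:P - 1).
Proof.
rewrite rmorphB !rmorphM rmorph_nat rmorph1 JC JX J1X.
apply/eqP; rewrite -subr_eq0 -oppr_eq0.
have -> : - (X i1 * X i1 - (2 * X i0 * X i2 - 1)) =
  quotalg_pi (principal_ideal (@quadric_eq_nonunit k)) (quadric_eq k).
  rewrite !rmorphB !rmorphM rmorph1 rmorph_nat -!/(xvar k _); ring.
rewrite -(rmorph0 (quotalg_pi (principal_ideal (@quadric_eq_nonunit k)))).
rewrite -[_ == _]/(_ == _ %[mod {ideal_quot _}])%qT -Quotient.idealrBE subr0.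
by apply/asboolP; exists 1; rewrite mul1r.
Qed.

Lemma normal z : exists q0 q1, z = J q0 + X i1 * J q1.
Proof.
suff : z \in [pred z | `[< exists q0 q1, z = J q0 + X i1 * J q1 >] ] by move/asboolP.
apply: quadric_ind.
  split; first by apply/asboolP; exists 1, 0; rewrite rmorph1 rmorph0 mulr0 addr0.
    move=> c u v /asboolP[p [q ->]] /asboolP[r [s ->]]; apply/asboolP.
    have ZJ q' : J (c%:P%:P * q') = c *: J q'.
      by rewrite rmorphM JC J1C -scalerAl mul1r.
    exists (c%:P%:P * p + r), (c%:P%:P * q + s).
    by rewrite ![J (_ + _)]rmorphD !ZJ scalerDr mulrDr -scalerAr addrACA.
  move=> u v /asboolP[p [q ->]] /asboolP[r [s ->]]; apply/asboolP.
  exists (p * r + (2 * 'X * ('X)%:P - 1) * (q * s)), (p * s + q * r).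
  rewrite ![J (_ + _)]rmorphD ![J (_ * _)]rmorphM -rel ; ring.
move=> j; apply/asboolP; case: j => [[|[|[|//]]]] hj.
- exists 'X, 0; rewrite rmorph0 mulr0 addr0 JX.
  by congr xvar; apply/val_inj.
- exists 0, 1; rewrite rmorph0 rmorph1 mulr1 add0r.
  by congr xvar; apply/val_inj.
exists ('X)%:P, 0; rewrite rmorph0 mulr0 addr0 JC J1X.
by congr xvar; apply/val_inj.
Qed.

Lemma psi_inj : injective psi.
Proof.
suff ker z : psi z = 0 -> z = 0.
  by move=> u v uv; apply/subr0_eq/ker; rewrite rmorphB /= uv subrr.
have [q0 [q1 ->]] := normal z => z0.
have n2 : (2 : k) != 0 := natk 1.
have key (u v : k) : q0.[u%:P].[v] = 0 /\ (2 * u * v - 1) * q1.[u%:P].[v] = 0.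
  have [s ss] := sqr_ex (2 * u * v - 1).
  have aux t : t * t = 2 * u * v - 1 -> q0.[u%:P].[v] + t * q1.[u%:P].[v] = 0.
    move=> tt; have [|g [g0 g1 g2]] := pt_onto (v0 := u) (v1 := t) (v2 := v).
      by rewrite tt; ring.
    have /(congr1 (fun f : SL2fun k => f g)) := z0.
    rewrite rmorphD rmorphM.
    rewrite -[LHS]/(psi (J q0) g + psi (X i1) g * psi (J q1) g).
    by rewrite !psiJ psi_var g0 g1 g2.
  have e1 := aux s ss.
  have e2 : q0.[u%:P].[v] + (- s) * q1.[u%:P].[v] = 0 by apply: aux; rewrite mulrNN.
  have Q0 : q0.[u%:P].[v] = 0.
    apply: (mulfI n2); rewrite mulr0 -[RHS]addr0 -{1}e1 -e2; ring.
  split=> //; rewrite -ss -mulrA.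
  by move: e1; rewrite Q0 add0r => ->; rewrite mulr0.
have -> : q0 = 0 by apply: poly2_inf => u v; case: (key u v).
suff -> : q1 = 0 by rewrite !rmorph0 mulr0 addr0.
have : (2 * 'X * ('X)%:P - 1) * q1 = 0.
  apply: poly2_inf => u v; case: (key u v) => _ <-.
  by rewrite !hornerE /=; ring.
move/eqP; rewrite mulf_eq0 => /orP[|/eqP//].
move/eqP/(congr1 (fun q => q.[0].[0])); rewrite !hornerE /= => /eqP.
by rewrite ?(mulr0, mul0r, sub0r) oppr_eq0 oner_eq0.
Qed.


Lemma torusE (t : 'M[k]_2) :
  torus t <-> [/\ t a0 a1 = 0, t a1 a0 = 0 & t a0 a0 * t a1 a1 = 1].
Proof.
split=> [[/is_diag_mxP dg dt]|[z1 z2 e]].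
  have z1 : t a0 a1 = 0 by apply: dg.
  have z2 : t a1 a0 = 0 by apply: dg.
  by split=> //; rewrite -dt detE z1 mul0r subr0.
split; last by rewrite detE z1 mul0r subr0.
have two (r : 'I_2) : r = a0 \/ r = a1.
  by case: r => [[|[|//]] ?]; [left|right]; apply/val_inj.
apply/is_diag_mxP => r s.
by case: (two r) => ->; case: (two s) => -> //; rewrite eqxx.
Qed.

Lemma normalizer_intro (n m : 'M[k]_2) : \det n = 1 -> n *m m = 1%:M ->
  (forall t, torus (n *m t *m m) <-> torus t) -> torus_normalizer n.
Proof.
move=> dn nm H; split=> // t.
have un : n \in unitmx by rewrite unitmxE dn unitr1.
by have -> : invmx n = m by rewrite -[m](mulKmx un) nm mulmx1.
Qed.

Definition w : 'M[k]_2 := mk 0 1 (-1) 0.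
Lemma w_norm : torus_normalizer w.
Proof.
apply: (@normalizer_intro _ (mk 0 (-1) 1 0)).
- by rewrite det_mk; ring.
- by apply: mxeq2; rewrite !mulE !mxE /=; ring.
move=> t; rewrite !torusE !mulE !mxE /=.
rewrite !(mul0r, mulr0, add0r, addr0, mul1r, mulr1, mulN1r, mulrN1, opprK).
split=> -[h1 h2 h3]; split; rewrite ?h1 ?h2 ?oppr0 //.
- by apply/eqP; rewrite -oppr_eq0 h2.
- by apply/eqP; rewrite -oppr_eq0 h1.
- by rewrite mulrC.
by rewrite mulrC.
Qed.

Definition dt (t : k) : 'M[k]_2 := mk t 0 0 t^-1.
Lemma dt_norm t : t != 0 -> torus_normalizer (dt t).
Proof.
move=> t0; have ti0 : t^-1 != 0 by rewrite invr_eq0.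
apply: (@normalizer_intro _ (mk t^-1 0 0 t)).
- by rewrite det_mk divff // mulr0 subr0.
- by apply: mxeq2; rewrite !mulE !mxE /= ?divff ?mulVf //; ring.
move=> m; rewrite !torusE !mulE !mxE /=.
rewrite !(mul0r, mulr0, add0r, addr0).
have -> : t * m a0 a0 * t^-1 = m a0 a0 by rewrite mulrAC divff // mul1r.
have -> : t^-1 * m a1 a1 * t = m a1 a1 by rewrite mulrAC mulVf // mul1r.
split=> -[h1 h2 h3]; split=> //; rewrite ?h1 ?h2 ?(mul0r, mulr0) //.
- by move/eqP: h1; rewrite !mulf_eq0 (negPf t0) orbF /= => /eqP.
- by move/eqP: h2; rewrite !mulf_eq0 (negPf ti0) orbF /= => /eqP.
Qed.

Definition act (g : SL2 k) (n : 'M[k]_2) (hn : torus_normalizer n) : SL2 k.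
Proof.
by exists (val g *m n); rewrite det_mulmx (eqP (valP g)) (proj1 hn) mul1r.
Defined.

Lemma sub_mem (z : quadric k) : (z \in inQ) = in_quadratic z. Proof. by []. Qed.
Lemma XX j l : X j * X l \in inQ. Proof. exact: quadratic_monomial_subproof. Qed.

Lemma parity z : exists e (o : 'I_3 -> quadric k),
  [/\ e \in inQ, forall j, o j \in inQ & z = e + \sum_j X j * o j].
Proof.
suff : z \in [pred z | `[< exists e (o : 'I_3 -> quadric k),
  [/\ e \in inQ, forall j, o j \in inQ & z = e + \sum_j X j * o j] >] ] by move/asboolP.
apply: quadric_ind.
- split.
  + apply/asboolP; exists 1, (fun=> 0); split; [exact: rpred1|by move=> j; rewrite rpred0|].
    by rewrite big1 ?addr0 // => j _; rewrite mulr0.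
  + move=> c u v /asboolP[e [o [eQ oQ ->]]] /asboolP[e' [o' [eQ' oQ' ->]]].
    apply/asboolP; exists (c *: e + e'), (fun j => c *: o j + o' j); split.
    * by rewrite rpredD ?rpredZ.
    * by move=> j; rewrite rpredD ?rpredZ.
    rewrite scalerDr addrACA scaler_sumr -big_split /=; congr (_ + _).
    by apply: eq_bigr => j _; rewrite mulrDr scalerAr.
  move=> u v /asboolP[e [o [eQ oQ ->]]] /asboolP[e' [o' [eQ' oQ' ->]]].
  apply/asboolP.
  exists (e * e' + (\sum_j X j * o j) * (\sum_j X j * o' j)),
    (fun j => e * o' j + o j * e'); split.
  * apply: rpredD; [exact: rpredM|rewrite big_distrlr /=].
    apply: rpred_sum => j _; apply: rpred_sum => l _.
    by rewrite mulrACA; apply: rpredM; [exact: XX|exact: rpredM].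
  * by move=> j; rewrite rpredD ?rpredM.
  rewrite mulrDl !mulrDr -!addrA; congr (_ + _).
  rewrite [LHS]addrA [LHS]addrC; congr (_ + _).
  rewrite mulr_sumr mulr_suml -big_split /=.
  by apply: eq_bigr => j _; rewrite mulrDr !mulrA [e * _]mulrC.
move=> j; apply/asboolP; exists 0, (fun l => (l == j)%:R); split.
- by rewrite rpred0.
- by move=> l; rewrite rpred_nat.
rewrite add0r (bigD1 j) //= eqxx mulr1 big1 ?addr0 // => l /negPf ->.
by rewrite mulr0.
Qed.

Definition mon (g : 'M[k]_2) (a b c d : nat) : k :=
  g a0 a0 ^+ a * g a0 a1 ^+ b * g a1 a0 ^+ c * g a1 a1 ^+ d.

Lemma psi_ab g : psi (- i *: X i0) g = val g a0 a0 * val g a0 a1.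
Proof.
rewrite psiZ -[LHS]/(- i * psi (X i0) g) psi_var /pt /=.
by transitivity (- (i * i) * (val g a0 a0 * val g a0 a1)); [ring|rewrite ii opprK mul1r].
Qed.
Lemma psi_ad g : psi (2^-1 *: (1 - i *: X i1)) g = val g a0 a0 * val g a1 a1.
Proof.
have n2 : (2 : k) != 0 := natk 1.
rewrite psiZ rmorphB /= psiZ rmorph1 -[LHS]/(2^-1 * (1 - i * psi (X i1) g)) psi_var.
rewrite /pt /= mulrA ii mulN1r opprK.
have /eqP := valP g; rewrite detE => dg.
by rewrite -[X in X + _]dg; field.
Qed.
Lemma psi_bc g : psi (2^-1 *: (- 1 - i *: X i1)) g = val g a0 a1 * val g a1 a0.
Proof.
have n2 : (2 : k) != 0 := natk 1.
rewrite psiZ rmorphB /= psiZ rmorphN1 -[LHS]/(2^-1 * (- 1 - i * psi (X i1) g)) psi_var.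
rewrite /pt /= mulrA ii mulN1r opprK.
have /eqP := valP g; rewrite detE => dg.
by rewrite -[X in - X + _]dg; field.
Qed.
Lemma psi_cd g : psi ((- i / 2) *: X i2) g = val g a1 a0 * val g a1 a1.
Proof.
have n2 : (2 : k) != 0 := natk 1.
rewrite psiZ -[LHS]/(- i / 2 * psi (X i2) g) psi_var /pt /=.
have -> (y : k) : - i / 2 * (2 * i * y) = - (i * i) * y by field.
by rewrite ii opprK mul1r.
Qed.

Lemma psi_mon (a b c d : nat) : (a + c = b + d)%N ->
  exists z, forall g, psi z g = mon (val g) a b c d.
Proof.
have mulS z1 z2 g : psi (z1 * z2) g = psi z1 g * psi z2 g by rewrite rmorphM.
elim: a b c d => [|a IHa] b c d.
  elim: c b d => [|c IHc] b d.
    case: b d => [|//] [|//] _; exists 1 => g.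
    by rewrite rmorph1 /mon !expr0 !mulr1.
  case: b => [|b].
    case: d => [//|d] e; have [|z Hz] := IHc 0%N d.
      by move: e; rewrite !add0n => -[].
    by exists (z * ((- i / 2) *: X i2)) => g; rewrite mulS psi_cd Hz /mon !exprS; ring.
  move=> e; have [|z Hz] := IHc b d; first by move: e; rewrite !add0n addSn => -[].
  by exists (z * (2^-1 *: (- 1 - i *: X i1))) => g; rewrite mulS psi_bc Hz /mon !exprS; ring.
case: b => [|b].
  case: d => [|d e]; first by rewrite addSn.
  have [|z Hz] := IHa 0%N c d; first by move: e; rewrite addSn add0n => -[].
  by exists (z * (2^-1 *: (1 - i *: X i1))) => g; rewrite mulS psi_ad Hz /mon !exprS; ring.
move=> e; have [|z Hz] := IHa b c d; first by move: e; rewrite !addSn => -[].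
by exists (z * (- i *: X i0)) => g; rewrite mulS psi_ab Hz /mon !exprS; ring.
Qed.

Definition ex (m : 'X_{1.. 2 * 2}) u v := m (mxvec_index u v).
Definition monm (g : 'M[k]_2) (m : 'X_{1.. 2 * 2}) :=
  mon g (ex m a0 a0) (ex m a0 a1) (ex m a1 a0) (ex m a1 a1).

Lemma prod2 (f : 'I_2 -> k) : \prod_u f u = f a0 * f a1.
Proof. by rewrite !big_ord_recl big_ord0 mulr1 l00. Qed.

Lemma eval_monm (P : {mpoly k[2 * 2]}) (g : 'M[k]_2) :
  P.@[mxvec g 0] = \sum_(m <- msupp P) P@_m * monm g m.
Proof.
rewrite mevalE; apply: eq_bigr => m _; congr (_ * _).
rewrite (reindex (uncurry (@mxvec_index 2 2))) /=; last exact: curry_mxvec_bij.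
transitivity (\prod_(p : 'I_2 * 'I_2) ((mxvec g) 0 (mxvec_index p.1 p.2) ^+ ex m p.1 p.2)).
  by apply: eq_bigr => -[].
rewrite -(pair_bigA _ (fun u v => (mxvec g) 0 (mxvec_index u v) ^+ ex m u v)) /=.
by rewrite !prod2 !mxvecE /monm /mon !mulrA.
Qed.

Definition wp m := (ex m a0 a0 + ex m a1 a0)%N.
Definition wn m := (ex m a0 a1 + ex m a1 a1)%N.

Lemma monm_dt t g m D : t != 0 -> (wn m <= D)%N ->
  monm (g *m dt t) m * t ^+ D = monm g m * t ^+ (D - wn m + wp m).
Proof.
move=> t0 le; rewrite -{1}(subnK le) /monm /mon !mulE !mxE /=.
rewrite !(mulr0, add0r, addr0) !exprMn /wp /wn !exprD !exprVn.
have h n : t ^+ n != 0 by rewrite expf_neq0.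
move: (h (ex m a0 a1)) (h (ex m a1 a1)).
move: (t ^+ ex m a0 a0) (t ^+ ex m a0 a1) (t ^+ ex m a1 a0) (t ^+ ex m a1 a1).
move: (t ^+ _) (g a0 a0 ^+ _) (g a0 a1 ^+ _) (g a1 a0 ^+ _) (g a1 a1 ^+ _).
by move=> ? ? ? ? ? ? ? ? ? ? ?; field; apply/andP.
Qed.

Lemma weight0 (f : SL2fun k) P : (forall g : SL2 k, f g = P.@[mxvec (val g) 0]) ->
  right_invariant f ->
  forall g : SL2 k, f g = \sum_(m <- msupp P | wp m == wn m) P@_m * monm (val g) m.
Proof.
move=> fP fI g.
pose D := (\max_(m <- msupp P) wn m)%N.
have leD m : m \in msupp P -> (wn m <= D)%N by move=> h; apply: leq_bigmax_seq.
pose Q : {poly k} := \sum_(m <- msupp P) (P@_m * monm (val g) m) *: 'X^(D - wn m + wp m)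
  - f g *: 'X^D.
have Q0 : Q = 0.
  apply: (@poly_inf _ (fun n => n.+1%:R)) => [m n /nat_inj[]//|n].
  set t : k := n.+1%:R; have t0 : t != 0 := natk n.
  rewrite /Q hornerD hornerN hornerZ hornerXn horner_sum.
  rewrite -(fI g (act g (dt_norm t0)) _ (dt_norm t0) erefl) fP eval_monm /=.
  rewrite mulr_suml -sumrB big1_seq // => m /andP[_ /leD le].
  by rewrite hornerZ hornerXn -[X in X - _]mulrA -[X in _ - X]mulrA -monm_dt // subrr.
have /(congr1 (fun q : {poly k} => q`_D)) := Q0.
rewrite /Q coefB coefZ coefXn eqxx mulr1 coef0 coef_sum => /subr0_eq <-.
rewrite [RHS]big_mkcond /= !big_seq; apply: eq_bigr => m /leD le.
rewrite coefZ coefXn -{1}(subnK le) eqn_add2l eq_sym.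
by case: ifP; rewrite ?mulr1 ?mulr0.
Qed.

Lemma psi_surjT (f : SL2fun k) : regular f -> right_invariant f -> exists z, psi z = f.
Proof.
move=> [P fP] fI.
have [z Hz] : exists z, forall g,
    psi z g = \sum_(m <- msupp P | wp m == wn m) P@_m * monm (val g) m.
  elim: (msupp P) => [|m s [z Hz]]; first by exists 0 => g; rewrite rmorph0 big_nil.
  have [/eqP e|e] := boolP (wp m == wn m); last first.
    by exists z => g; rewrite big_cons (negPf e).
  have [y Hy] := psi_mon e.
  exists (P@_m *: y + z) => g; rewrite big_cons e eqxx -Hz rmorphD /= psiZ.
  by rewrite -[LHS]/(P@_m * psi y g + psi z g) Hy.
by exists z; apply/funext => g; rewrite Hz (weight0 fP fI).
Qed.

Lemma psi_surj (f : SL2fun k) : regular f -> right_invariant f ->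
  exists2 z, z \in inQ & psi z = f.
Proof.
move=> fr fI; have [z zf] := psi_surjT fr fI.
have [e [o [eQ oQ ze]]] := parity z.
exists e => //; apply/funext => g.
have n2 : (2 : k) != 0 := natk 1.
pose h := act g w_norm.
have ptw j : pt (val h) j = - pt (val g) j.
  by rewrite /pt /= !mulE !mxE /=; case: ifP => _; [|case: ifP => _]; ring.
have odd : psi (\sum_j X j * o j) h = - psi (\sum_j X j * o j) g.
  elim/big_ind: _ => [|a b|j _]; first by rewrite rmorph0 -[RHS]/(- 0) oppr0.
    rewrite rmorphD -[(_ + _) h]/(psi a h + psi b h) => -> ->.
    by rewrite -opprD.
  rewrite rmorphM -[(_ * _) h]/(psi (X j) h * psi (o j) h).
  rewrite -[(_ * _) g]/(psi (X j) g * psi (o j) g) !psi_var ptw mulNr.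
  by rewrite (@psi_inv _ (oQ j) g h w w_norm erefl).
have fg : f g = psi e g + psi (\sum_j X j * o j) g by rewrite -zf ze rmorphD.
have fh : f h = psi e h + psi (\sum_j X j * o j) h by rewrite -zf ze rmorphD.
rewrite (fI g h w w_norm erefl) odd (@psi_inv _ eQ g h w w_norm erefl) fg in fh.
suff z0 : psi (\sum_j X j * o j) g = 0 by rewrite fg z0 addr0.
move/addrI: fh => fh; apply: (mulfI n2).
by rewrite mulr0 mulr_natl mulr2n {2}fh subrr.
Qed.

Lemma phi_sub (z : quadratic k) : psi (val z) \in @in_OX k.
Proof.
apply/asboolP; split; first exact: psi_regular.
by apply: psi_inv => //; exact: (valP z).
Qed.
Definition phi (z : quadratic k) : OX k := RegularFun (phi_sub z).
Fact phi_zmod : zmod_morphism phi.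
Proof. by move=> u v; apply/val_inj; rewrite /= !rmorphB. Qed.
Fact phi_monoid : monoid_morphism phi.
Proof. by split=> [|u v]; apply/val_inj; rewrite /= ?rmorph1 ?rmorphM. Qed.
Fact phi_scalable : scalable phi.
Proof. by move=> c u; apply/val_inj; rewrite /= psiZ. Qed.
HB.instance Definition _ := GRing.isZmodMorphism.Build _ _ phi phi_zmod.
HB.instance Definition _ := GRing.isMonoidMorphism.Build _ _ phi phi_monoid.
HB.instance Definition _ := GRing.isScalable.Build _ _ _ _ phi phi_scalable.

Lemma phi_bij : bijective phi.
Proof.
have inj : injective phi.
  by move=> u v /(congr1 val) /= /psi_inj /val_inj.
have sur f : exists z, phi z == f.
  have /asboolP[fr fi] := valP f; have [z zQ zf] := psi_surj fr fi.
  by exists (Quadratic zQ); apply/eqP/val_inj.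
exists (fun f => xchoose (sur f)) => [z|f]; last exact/eqP/(xchooseP (sur f)).
by apply/inj/eqP/(xchooseP (sur (phi z))).
Qed.
End Identification.

Theorem isomorphic (k : closedFieldType) : [pchar k] =i pred0 ->
  alg_isomorphic (quadratic k) (OX k).
Proof.
move=> char0; have [i] := ex_sqrtN1 k; rewrite expr2 => ii.
by exists (phi char0 ii); exact: phi_bij.
Qed.
End QuadraticOX.

(* Main.v *)
Require Import Defs.
From HB Require Import structures.
From mathcomp Require Import all_boot all_algebra.
From mathcomp Require Import boolp mpoly ring zify.

Set Implicit Arguments.
Unset Strict Implicit.
Unset Printing Implicit Defensive.

Import GRing.Theory.
Import (canonicals) QuadraticOX.
Local Open Scope ring_scope.

(** Write [R] for [quadratic k], which is isomorphic to [OX k].  Put [x = x0],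
[y = x1] and [z = (y^2 + 1) / x^n].  Then [R] is the even part, for the involution
changing the signs of [x], [y] and [z], of the ring of the surface
[x^n z = y^2 + 1] with [n = 1] (there [z = 2 x2]), while [Rtilde] is the even part
for [n = 3]: the equation [F = 0] gives [T] the value
[y (y^2 + 1) (3 y^2 + 7) / (60 x^3)].

The cylinders over the two surfaces are isomorphic by the trick of Danielewski.
Concretely, [R[T]] has the locally nilpotent derivation [x0 -> 0], [x1 -> x0],
[x2 -> x1], [T -> x2^2], and it sends [F] to the constant 2 ([F_slice]).  An algebra
with a locally nilpotent derivation taking the value 1 at some [s] is a polynomial
ring over its quotient by [s] ([slice_theorem]), so [R[T]] is a polynomial ring over
[R[T] / (F)].

The surfaces are told apart by their locally nilpotent derivations.  The group
[SL_2] acts on [R], and its two opposite unipotent subgroups give locally nilpotent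
derivations with different kernels.  On [Rtilde] all nonzero locally nilpotent
derivations have the same kernel ([locally_nilpotent_same_kernel]), because all of
them kill [x^2] ([locally_nilpotent_kills_mon00]).

To see the latter, use the torus action with weights 1, 0, -3 on [x], [y], [z].  The
lowest homogeneous component of a locally nilpotent derivation [D] is locally
nilpotent.  If its degree were negative it would kill [z^2], as it sends
[z^2] to a multiple of [z^2]; its exponential would then parametrize the curve
[z x^3 = y^2 + 1], over the field generated by [z], by nonconstant polynomials, and
a degree count excludes this ([cusp_rigidity], [lowers_pred]).  So no component of
[D] has negative degree, [D (x^2)] is a multiple of [x^2], and a locally nilpotent
derivation sends an element to a multiple of itself only if it kills it.

Everything on [Rtilde] is computed in the function field [k(x, y)], in which it
embeds ([Rtilde_embedding]); that [Rtilde] is a domain is taken from the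
isomorphism of the cylinders. *)

(** * Locally nilpotent derivations and the slice theorem *)

Section Derivations.
Variables (k : fieldType) (A : comAlgType k).
Implicit Types (D : A -> A) (a b : A).

Definition derivation D : Prop :=
  linear D /\ forall a b, D (a * b) = D a * b + a * D b.

Definition locally_nilpotent D : Prop := forall a, exists n, iter n D a = 0.

Variable D : A -> A.
Hypothesis derD : derivation D.

Lemma derivationM a b : D (a * b) = D a * b + a * D b.
Proof. exact: derD.2. Qed.

Lemma derivationP c a b : D (c *: a + b) = c *: D a + D b.
Proof. exact: derD.1. Qed.

Lemma derivationD a b : D (a + b) = D a + D b.
Proof. by have := derivationP 1 a b; rewrite !scale1r. Qed.

Lemma derivation0 : D 0 = 0.
Proof. by apply: (addrI (D 0)); rewrite -derivationD !addr0. Qed.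

Lemma derivationZ c a : D (c *: a) = c *: D a.
Proof. by have := derivationP c a 0; rewrite derivation0 !addr0. Qed.

Lemma derivationN a : D (- a) = - D a.
Proof. by rewrite -!scaleN1r derivationZ. Qed.

Lemma derivationB a b : D (a - b) = D a - D b.
Proof. by rewrite derivationD derivationN. Qed.

Lemma derivation_sum (I : Type) (r : seq I) (P : pred I) (f : I -> A) :
  D (\sum_(i <- r | P i) f i) = \sum_(i <- r | P i) D (f i).
Proof. exact: (big_morph D derivationD derivation0). Qed.

Lemma derivation1 : D 1 = 0.
Proof.
have := derivationM 1 1; rewrite !mulr1 mul1r => /eqP.
by rewrite -subr_eq subrr => /eqP.
Qed.

Lemma derivation_const c : D c%:A = 0.
Proof. by rewrite derivationZ derivation1 scaler0. Qed.

Lemma derivation_nat n : D n%:R = 0.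
Proof. by rewrite -scaler_nat derivation_const. Qed.

Lemma derivation_natM n a : D (n%:R * a) = n%:R * D a.
Proof. by rewrite !mulr_natl -!scaler_nat derivationZ. Qed.

Lemma iter_derivationP n c a b :
  iter n D (c *: a + b) = c *: iter n D a + iter n D b.
Proof. by elim: n => //= n ->; rewrite derivationP. Qed.

Lemma iter_derivation0 n : iter n D 0 = 0.
Proof. by elim: n => //= n ->; rewrite derivation0. Qed.

Lemma iter_derivation_vanish m n a : (m <= n)%N -> iter m D a = 0 -> iter n D a = 0.
Proof. by move=> /subnK <- e; rewrite iterD e iter_derivation0. Qed.

Lemma kernel_derivation_subalg : subalg_closed [pred a | D a == 0].
Proof.
split; first by rewrite inE derivation1.
  by move=> c a b; rewrite !inE derivationP => /eqP-> /eqP->; rewrite scaler0 addr0.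
by move=> a b; rewrite !inE derivationM => /eqP-> /eqP->; rewrite mul0r mulr0 addr0.
Qed.

Section Exponential.
Hypothesis char0 : [pchar k] =i pred0.
Hypothesis nilD : locally_nilpotent D.

Lemma fact_neq0 n : (n`!%:R : k) != 0.
Proof. by have /pcharf0P -> := char0; rewrite -lt0n fact_gt0. Qed.

(** Dividing by the factorial turns the Leibniz rule into the Cauchy product: this is
what makes the exponential of a derivation multiplicative. *)
Definition divided_iter n a : A := n`!%:R^-1 *: iter n D a.

Lemma divided_iterP n c a b :
  divided_iter n (c *: a + b) = c *: divided_iter n a + divided_iter n b.
Proof.
by rewrite /divided_iter iter_derivationP scalerDr !scalerA mulrC.
Qed.

Lemma divided_iterS n a : n.+1%:R *: divided_iter n.+1 a = D (divided_iter n a).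
Proof.
rewrite /divided_iter derivationZ iterS scalerA factS natrM invfM mulrA.
by rewrite divff ?mul1r //; have /pcharf0P -> := char0.
Qed.

Lemma divided_iterM n a b : divided_iter n (a * b) =
  \sum_(i < n.+1) divided_iter i a * divided_iter (n - i) b.
Proof.
elim: n => [|n IH].
  by rewrite big_ord_recl big_ord0 addr0 /divided_iter fact0 invr1 !scale1r.
have n1 : (n.+1%:R : k) != 0 by have /pcharf0P -> := char0.
apply: (scalerI n1); rewrite divided_iterS IH derivation_sum scaler_sumr.
transitivity (\sum_(i < n.+1) ((i.+1%:R *: divided_iter i.+1 a) * divided_iter (n - i) b)
  + \sum_(i < n.+1) (divided_iter i a * ((n - i).+1%:R *: divided_iter (n - i).+1 b))).
  rewrite -big_split; apply: eq_bigr => i _.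
  by rewrite derivationM !divided_iterS.
have -> : \sum_(i < n.+1) (i.+1%:R *: divided_iter i.+1 a) * divided_iter (n - i) b
  = \sum_(i < n.+2) (i%:R *: divided_iter i a) * divided_iter (n.+1 - i) b.
  rewrite [RHS]big_ord_recl scale0r mul0r add0r.
  by apply: eq_bigr => i _; rewrite lift0 subSS.
have -> : \sum_(i < n.+1) (divided_iter i a * ((n - i).+1%:R *: divided_iter (n - i).+1 b))
  = \sum_(i < n.+2) (divided_iter i a * ((n.+1 - i)%:R *: divided_iter (n.+1 - i) b)).
  rewrite [RHS]big_ord_recr /= subnn scale0r mulr0 addr0.
  by apply: eq_bigr => i _; rewrite subSn // -ltnS.
rewrite -big_split; apply: eq_bigr => i _ /=.
move: (divided_iter i a) (divided_iter _ b) => u v.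
by rewrite -scalerAl -scalerAr -scalerDl -natrD subnKC // -ltnS.
Qed.

Definition nilpotency_index a : nat :=
  ex_minn (let: ex_intro n e := nilD a in
           ex_intro (fun n => iter n D a == 0) n (introT eqP e)).

Lemma nilpotency_indexP a n : (nilpotency_index a <= n)%N -> iter n D a = 0.
Proof.
rewrite /nilpotency_index; case: ex_minnP => m /eqP e _ mn.
exact: iter_derivation_vanish mn e.
Qed.

Definition exp_der a : {poly A} :=
  \poly_(n < nilpotency_index a) divided_iter n a.

Lemma coef_exp_der a n : (exp_der a)`_n = divided_iter n a.
Proof.
rewrite coef_poly; case: ltnP => // /nilpotency_indexP e.
by rewrite /divided_iter e scaler0.
Qed.

Fact exp_der_zmod : zmod_morphism exp_der.
Proof.
move=> a b; apply/polyP => n; rewrite coefB !coef_exp_der.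
by rewrite addrC -scaleN1r divided_iterP scaleN1r addrC.
Qed.

Fact exp_der_monoid : monoid_morphism exp_der.
Proof.
split=> [|a b]; apply/polyP => n.
  rewrite coef_exp_der coef1 /divided_iter; case: n => [|n].
    by rewrite fact0 invr1 scale1r.
  by rewrite iterSr derivation1 iter_derivation0 scaler0.
rewrite coefM coef_exp_der divided_iterM.
by apply: eq_bigr => i _; rewrite !coef_exp_der.
Qed.

(** The exponential [a |-> \sum_n D^n(a) / n! U^n].  It carries degree arguments
from polynomials over [A] back to the derivation. *)
Fact exp_map_subproof :
  {Phi : {rmorphism A -> {poly A}} | forall a n, (Phi a)`_n = divided_iter n a}.
Proof.
pose Phi : {rmorphism A -> {poly A}} := HB.pack exp_der
  (GRing.isZmodMorphism.Build A {poly A} exp_der exp_der_zmod)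
  (GRing.isMonoidMorphism.Build A {poly A} exp_der exp_der_monoid).
by exists Phi; exact: coef_exp_der.
Qed.

Definition exp_map : {rmorphism A -> {poly A}} := sval exp_map_subproof.

Lemma coef_exp_map a n : (exp_map a)`_n = divided_iter n a.
Proof. exact: (svalP exp_map_subproof). Qed.

Lemma exp_map_coef0 a : (exp_map a)`_0 = a.
Proof. by rewrite coef_exp_map /divided_iter fact0 invr1 scale1r. Qed.

Lemma exp_map_deriv a : exp_map (D a) = (exp_map a)^`().
Proof.
apply/polyP => n; rewrite coef_deriv !coef_exp_map -scaler_nat divided_iterS.
by rewrite /divided_iter derivationZ -iterS -iterSr.
Qed.

Lemma exp_map_kernel a : D a = 0 -> exp_map a = a%:P.
Proof.
move=> a0; apply/polyP => -[|n]; rewrite coefC /= ?exp_map_coef0 // coef_exp_map.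
by rewrite /divided_iter iterSr a0 iter_derivation0 scaler0.
Qed.
End Exponential.

Lemma locally_nilpotent_subalg (char0 : [pchar k] =i pred0) :
  subalg_closed [pred a | `[< exists n, iter n D a = 0 >]].
Proof.
split; first by apply/asboolP; exists 1%N; rewrite /= derivation1.
  move=> c a b /asboolP[m am] /asboolP[n bn]; apply/asboolP; exists (m + n)%N.
  rewrite iter_derivationP (iter_derivation_vanish _ am) ?leq_addr //.
  by rewrite (iter_derivation_vanish _ bn) ?leq_addl // scaler0 addr0.
move=> a b /asboolP[m am] /asboolP[n bn]; apply/asboolP; exists (m + n)%N.
suff : divided_iter (m + n) (a * b) = 0.
  move/eqP; rewrite scaler_eq0 invr_eq0 (negPf (fact_neq0 char0 _)) /=.
  by move/eqP.
rewrite divided_iterM // big1 // => i _; rewrite /divided_iter.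
have [le|lt] := leqP m i.
  by rewrite (iter_derivation_vanish le am) scaler0 mul0r.
rewrite (@iter_derivation_vanish n _ b) ?scaler0 ?mulr0 //.
by move: lt; lia.
Qed.

End Derivations.

Section SliceTheorem.
Variables (k : fieldType) (char0 : [pchar k] =i pred0) (A : comAlgType k).
Variables (D : A -> A) (derD : derivation D) (nilD : locally_nilpotent D).
Variables (s : A) (slice : D s = 1).
Variables (Q : comAlgType k) (pi : {lrmorphism A -> Q}).
Hypothesis pi_surj : forall q, exists a, pi a = q.
Hypothesis ker_pi : forall a, pi a = 0 <-> exists b, a = b * s.

Local Notation Phi := (exp_map derD char0 nilD).

Lemma exp_map_slice : Phi s = 'X + s%:P.
Proof.
apply/polyP => -[|[|n]]; rewrite coefD coefX coefC /= ?exp_map_coef0 ?add0r //.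
  by rewrite coef_exp_map /divided_iter /= slice invr1 scale1r addr0.
rewrite coef_exp_map /divided_iter !iterSr slice (derivation1 derD).
by rewrite (iter_derivation0 derD) scaler0.
Qed.

(** The exponential of the slice is monic of degree one in the parameter, so that
of a nonzero multiple of it is never constant. *)
Lemma kernel_slice_multiple b : D (b * s) = 0 -> b = 0.
Proof.
move=> /(exp_map_kernel derD char0 nilD) e.
have [//|nz] := eqVneq b 0.
have Pnz : Phi b != 0.
  by apply: contraNneq nz => P0; rewrite -[b](exp_map_coef0 derD char0 nilD) P0 coef0.
move: e; rewrite rmorphM exp_map_slice => /(congr1 (fun p : {poly A} => size p)).
have mon : 'X + s%:P \is monic by rewrite -[s]opprK polyCN monicXsubC.
rewrite size_Mmonic // -[s]opprK polyCN size_XsubC addn2 /=.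
move=> e; have := size_polyC_leq1 (b * - - s); rewrite -e.
by rewrite ltnS leqn0 size_poly_eq0 (negPf Pnz).
Qed.

(** The exponential reduced modulo the slice: geometrically, the flow restricted
to the hypersurface on which the slice vanishes. *)
Definition slice_map : {rmorphism A -> {poly Q}} := map_poly pi \o Phi.

(** The leading coefficient of an exponential is killed by [D]; it cannot also be
a multiple of the slice. *)
Lemma slice_map_inj : injective slice_map.
Proof.
suff ker a : slice_map a = 0 -> a = 0.
  move=> a b ab; apply/subr0_eq/ker.
  by rewrite rmorphB ab subrr.
move=> a0; have [//|nz] := eqVneq a 0.
have Pnz : Phi a != 0.
  by apply: contraNneq nz => P0; rewrite -[a](exp_map_coef0 derD char0 nilD) P0 coef0.
have /ker_pi[b eb] : pi (lead_coef (Phi a)) = 0.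
  by rewrite lead_coefE -coef_map -[map_poly pi _]/(slice_map a) a0 coef0.
have : D (lead_coef (Phi a)) = 0.
  rewrite lead_coefE coef_exp_map -divided_iterS // -(coef_exp_map derD char0 nilD).
  by rewrite nth_default ?scaler0 // prednK ?leqnn // lt0n size_poly_eq0.
rewrite eb => /kernel_slice_multiple b0.
by move: Pnz; rewrite -lead_coef_eq0 eb b0 mul0r eqxx.
Qed.

(** The image contains the variable, which is the image of the slice.  It then
contains each constant, by induction on the nilpotency order of a representative:
the higher coefficients of its exponential have smaller nilpotency order. *)
Lemma slice_map_surj q : exists a, slice_map a = q.
Proof.
have addI p r : (exists a, slice_map a = p) -> (exists a, slice_map a = r) ->
    exists a, slice_map a = p + r.
  by move=> [a <-] [b <-]; exists (a + b); rewrite /slice_map !rmorphD.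
have mulI p r : (exists a, slice_map a = p) -> (exists a, slice_map a = r) ->
    exists a, slice_map a = p * r.
  by move=> [a <-] [b <-]; exists (a * b); rewrite /slice_map !rmorphM.
have varI : exists a, slice_map a = 'X.
  exists s; rewrite /slice_map /= exp_map_slice rmorphD /= map_polyX map_polyC /=.
  have /ker_pi -> : exists b, s = b * s by exists 1; rewrite mul1r.
  by rewrite addr0.
have powI n : exists a, slice_map a = 'X^n.
  elim: n => [|n IH]; first by exists 1; rewrite /slice_map !rmorph1.
  by rewrite exprS; apply: (mulI _ _).
have constI n a : iter n D a = 0 -> exists b, slice_map b = (pi a)%:P.
  elim/ltn_ind: n a => -[|n] IH a Dna.
    by exists 0; rewrite /slice_map rmorph0 -[a]/(iter 0 D a) Dna !rmorph0.
  have -> : (pi a)%:P =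
      slice_map a + \sum_(i < n) - (pi (divided_iter D i.+1 a))%:P * 'X^(i.+1).
    apply/polyP => j; rewrite coefD coef_sum coef_map /= coef_exp_map coefC.
    have term (i : 'I_n) : (- (pi (divided_iter D i.+1 a))%:P * 'X^(i.+1) : {poly Q})`_j =
        if j == i.+1 :> nat then - pi (divided_iter D j a) else 0.
      rewrite -polyCN coefCM coefXn; case: eqP => [->|_]; first by rewrite mulr1.
      by rewrite mulr0.
    under eq_bigr do rewrite term.
    case: j {term} => [|j].
      rewrite big1 ?addr0 // /divided_iter.
      by rewrite fact0 invr1 scale1r.
    have [lt|le] := ltnP j n.
      rewrite (bigD1 (Ordinal lt)) //= eqxx big1 ?addr0 ?subrr //.
      by move=> i /eqP ij; rewrite eqSS; case: eqP => // e; case: ij; apply/val_inj.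
    rewrite big1 ?addr0 => [|i _].
      by rewrite /divided_iter (iter_derivation_vanish derD _ Dna) ?scaler0 ?rmorph0.
    by rewrite eqSS gtn_eqF // (leq_trans (ltn_ord i)).
  apply: (addI _ _); first by exists a.
  elim/big_ind: _ => [||i _]; [by exists 0; rewrite /slice_map !rmorph0|exact addI|].
  rewrite -polyCN -rmorphN; apply: (mulI _ _) => //; apply: (IH (n - i)%N).
    by rewrite ltnS leq_subr.
  rewrite /divided_iter -scalerN.
  have iterZ c b m : iter m D (c *: b) = c *: iter m D b.
    by have := iter_derivationP derD m c b 0; rewrite (iter_derivation0 derD) !addr0.
  rewrite iterZ -scaleN1r iterZ -iterD addnS subnK ?(ltnW (ltn_ord i)) //.
  by rewrite Dna !scaler0.
rewrite -[q]coefK poly_def; elim/big_ind: _ => [||i _].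
- by exists 0; rewrite /slice_map !rmorph0.
- exact addI.
rewrite -mul_polyC; apply: (mulI _ _) => //.
have [a <-] := pi_surj q`_i; have [n Dna] := nilD a.
exact: (constI _ _ Dna).
Qed.

Theorem slice_theorem : alg_isomorphic A (polyalg Q).
Proof.
pose g : A -> polyalg Q := slice_map.
have zm : zmod_morphism g by exact: rmorphB.
have mm : monoid_morphism g by split; [exact: rmorph1|exact: rmorphM].
have sc : scalable g.
  move=> c a; rewrite -[c *: a]mul1r -scalerAr scalerAl mm.2; congr (_ * _).
  rewrite /g /slice_map /= (exp_map_kernel derD) ?(derivation_const derD) //.
  by rewrite map_polyC /= linearZ rmorph1.
pose f : {lrmorphism A -> polyalg Q} := HB.pack g
  (GRing.isZmodMorphism.Build A (polyalg Q) g zm)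
  (GRing.isMonoidMorphism.Build A (polyalg Q) g mm)
  (GRing.isScalable.Build k A (polyalg Q) *:%R g sc).
exists f; have surj q : exists a, g a == q.
  by have [a <-] := slice_map_surj q; exists a.
exists (fun q => xchoose (surj q)) => [a|q]; last exact/eqP/(xchooseP (surj q)).
by apply: slice_map_inj; apply/eqP/(xchooseP (surj (f a))).
Qed.
End SliceTheorem.

Section Isomorphism.
Variable k : fieldType.

Lemma alg_isomorphic_sym (A B : algType k) :
  alg_isomorphic A B -> alg_isomorphic B A.
Proof.
move=> [f [g fK gK]].
have fI := can_inj fK.
have zm : zmod_morphism g by move=> a b; apply: (fI _ _); rewrite rmorphB /= !gK.
have mm : monoid_morphism g.
  by split=> [|a b]; apply: (fI _ _); rewrite ?rmorph1 ?rmorphM /= !gK.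
have sc : scalable g by move=> c a; apply: (fI _ _); rewrite linearZ /= !gK.
pose h : {lrmorphism B -> A} := HB.pack g
  (GRing.isZmodMorphism.Build B A g zm)
  (GRing.isMonoidMorphism.Build B A g mm)
  (GRing.isScalable.Build k B A *:%R g sc).
by exists h; exists f.
Qed.

Lemma alg_isomorphic_trans (A B C : algType k) :
  alg_isomorphic A B -> alg_isomorphic B C -> alg_isomorphic A C.
Proof.
move=> [f fb] [g gb]; exists (g \o f : {lrmorphism A -> C}).
exact: bij_comp gb fb.
Qed.

Lemma alg_isomorphic_polyalg (A B : comAlgType k) :
  alg_isomorphic A B -> alg_isomorphic (polyalg A) (polyalg B).
Proof.
move=> [f [g fK gK]].
pose h : polyalg A -> polyalg B := map_poly f.
have zm : zmod_morphism h by move=> p q; rewrite /h rmorphB.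
have mm : monoid_morphism h by split=> [|p q]; rewrite /h ?rmorph1 ?rmorphM.
have sc : scalable h.
  move=> c p; rewrite -[h _]/(h ((c%:A)%:P * p)) mm.2 /h map_polyC /=.
  by rewrite linearZ rmorph1.
pose h' : {lrmorphism polyalg A -> polyalg B} := HB.pack h
  (GRing.isZmodMorphism.Build (polyalg A) (polyalg B) h zm)
  (GRing.isMonoidMorphism.Build (polyalg A) (polyalg B) h mm)
  (GRing.isScalable.Build k (polyalg A) (polyalg B) *:%R h sc).
exists h'; have g0 : g 0 = 0 by rewrite -(rmorph0 f) fK.
exists (map_poly g) => p; apply/polyP => i.
  by rewrite coef_map_id0 // coef_map fK.
by rewrite coef_map /= coef_map_id0 // gK.
Qed.
End Isomorphism.

(** * Derivations of quotients and of polynomial rings *)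

Section Quotients.
Variables (k : fieldType) (A : comAlgType k) (s : A).
Hypothesis s_nonunit : forall b, b * s != 1.

Local Notation pi := (quotalg_pi (principal_ideal s_nonunit)).

Lemma quotalg_pi_eq0 a : pi a = 0 <-> exists b, a = b * s.
Proof.
rewrite -(rmorph0 pi); split.
  move=> /eqP; rewrite -[_ == _]/(_ == _ %[mod {ideal_quot _}])%qT.
  by rewrite -Quotient.idealrBE subr0 => /asboolP.
move=> h; apply/eqP; rewrite -[_ == _]/(_ == _ %[mod {ideal_quot _}])%qT.
by rewrite -Quotient.idealrBE subr0; apply/asboolP.
Qed.

Lemma quotalg_pi_surj q : exists a, pi a = q.
Proof. by have [a ->] := quotalg_piK q; exists a. Qed.
End Quotients.

Lemma quotient_derivation (k : fieldType) (A B : comAlgType k)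
    (pi : {lrmorphism A -> B}) (d : A -> A) : derivation d ->
    (forall b, exists a, pi a = b) -> (forall a, pi a = 0 -> pi (d a) = 0) ->
  exists2 D, derivation D & forall a, D (pi a) = pi (d a).
Proof.
move=> derd surj stable.
have surj' b : exists a, pi a == b by have [a <-] := surj b; exists a.
pose D b := pi (d (xchoose (surj' b))).
have DE a : D (pi a) = pi (d a).
  apply/subr0_eq; rewrite -rmorphB -(derivationB derd); apply: stable.
  by rewrite rmorphB; apply/eqP; rewrite subr_eq0 (xchooseP (surj' (pi a))).
exists D => //; split=> [c|] u v; have [a <-] := surj u; have [b <-] := surj v.
  by rewrite -linearP !DE (derivationP derd) linearP.
by rewrite -rmorphM !DE (derivationM derd) rmorphD !rmorphM.
Qed.

Section PolynomialDerivation.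
Variables (k : fieldType) (A : comAlgType k) (D : A -> A) (c : A).
Hypothesis derD : derivation D.

(** The derivation extending [D] that sends the variable to [c]. *)
Definition poly_derivation (p : polyalg A) : polyalg A :=
  \poly_(i < size p) D p`_i + c%:P * p^`().

Lemma coef_poly_derivation p i :
  (poly_derivation p)`_i = D p`_i + c * (p`_i.+1 *+ i.+1).
Proof.
rewrite coefD coefCM coef_deriv coef_poly; case: ltnP => // le.
by rewrite (nth_default 0 le) (derivation0 derD).
Qed.

Lemma poly_derivationC a : poly_derivation a%:P = (D a)%:P.
Proof.
apply/polyP => i; rewrite coef_poly_derivation !coefC.
by case: i => [|i] /=; rewrite ?(derivation0 derD) mul0rn mulr0 addr0.
Qed.

Lemma poly_derivationX : poly_derivation 'X = c%:P.
Proof.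
apply/polyP => i; rewrite coef_poly_derivation !coefX coefC.
case: i => [|[|i]] /=; rewrite ?(derivation0 derD) ?(derivation1 derD) ?add0r.
- by rewrite mulr1.
- by rewrite mul0rn mulr0.
by rewrite mul0rn mulr0.
Qed.

Lemma derivation_poly_derivation : derivation poly_derivation.
Proof.
split=> [a p q|p q]; apply/polyP => i.
  rewrite -[a *: p]/((a%:A)%:P * p) -[a *: poly_derivation p]/((a%:A)%:P * _).
  rewrite [LHS]coef_poly_derivation [RHS]coefD coefCM !coef_poly_derivation.
  rewrite !coefD !coefCM.
  rewrite (derivationD derD) (derivationM derD) (derivation_const derD).
  by rewrite mul0r add0r mulrnDl !mulrnAr; ring.
pose dp (r : polyalg A) : {poly A} := \poly_(i < size r) D r`_i.
have dpE r j : (dp r)`_j = D r`_j.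
  by rewrite coef_poly; case: ltnP => // le; rewrite (nth_default 0 le) (derivation0 derD).
have dpM : dp (p * q) = dp p * q + p * dp q.
  apply/polyP => j; rewrite dpE coefD !coefM (derivation_sum derD) -big_split.
  by apply: eq_bigr => m _; rewrite !dpE (derivationM derD).
congr (polyseq _)`_i; rewrite /poly_derivation -/(dp p) -/(dp q) -/(dp (p * q)).
rewrite dpM derivM; move: (dp p) (dp q) => u v.
by rewrite [LHS](_ : _ = (u + c%:P * p^`()) * q + p * (v + c%:P * q^`())) //; ring.
Qed.

Lemma poly_derivation_nilpotent (char0 : [pchar k] =i pred0) :
  locally_nilpotent D -> locally_nilpotent poly_derivation.
Proof.
move=> nilD; have [P1 PL PM] := locally_nilpotent_subalg derivation_poly_derivation char0.
set P := [pred _ | _] in P1 PL PM.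
suff H p : p \in P by move=> p; have /asboolP := H p.
have PC a : a%:P \in P.
  have [n an] := nilD a; apply/asboolP; exists n.
  suff -> : iter n poly_derivation a%:P = (iter n D a)%:P by rewrite an.
  by elim: {an} n => //= n ->; rewrite poly_derivationC.
have PX : 'X \in P.
  have /asboolP[n cn] := PC c; apply/asboolP; exists n.+1.
  by rewrite iterSr poly_derivationX.
have PD (u v : polyalg A) : u \in P -> v \in P -> u + v \in P.
  by move=> uP vP; rewrite -[u]scale1r; apply: PL.
elim/poly_ind: p => [|p a pP]; first exact: PC.
by apply: PD => //; apply: PM.
Qed.
End PolynomialDerivation.

(** * Derivations of the quadric *)

Section QuadricDerivations.
Variable k : closedFieldType.
Hypothesis char0 : [pchar k] =i pred0.

Local Notation X := (xvar k).
Local Notation pi := (quotalg_pi (principal_ideal (@quadric_eq_nonunit k))).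

Lemma derivation_vector_field (v : 'I_3 -> {mpoly k[3]}) :
  derivation (fun p : {mpoly k[3]} => \sum_i v i * mderiv i p).
Proof.
split=> [c p q|p q].
  rewrite scaler_sumr -big_split; apply: eq_bigr => i _ /=.
  by rewrite mderivD mderivZ mulrDr scalerAr.
rewrite mulr_suml mulr_sumr -big_split; apply: eq_bigr => i _ /=.
by rewrite mderivM; ring.
Qed.

Lemma quadric_derivation (v : 'I_3 -> {mpoly k[3]}) :
    \sum_i v i * mderiv i (quadric_eq k) = 0 ->
  exists2 D, derivation D & forall i, D (X i) = pi (v i).
Proof.
move=> v0; have derd := derivation_vector_field v.
have [|a|D derD DE] := quotient_derivation (pi := pi) derd.
- exact: quotalg_pi_surj.
- move=> /quotalg_pi_eq0[b ->]; apply/quotalg_pi_eq0.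
  exists (\sum_i v i * mderiv i b).
  by rewrite (derivationM derd) v0 mulr0 addr0.
exists D => // i; rewrite /xvar DE; congr (pi _).
rewrite (bigD1 i) //= big1 => [|j ji].
  rewrite mderivX mnm1E eqxx scale1r addr0.
  by rewrite -[X in _ * X](_ : 1 = _) ?mulr1 // -mpolyX0; congr mpolyX; apply/mnmP => j;
    rewrite mnmBE subnn mnm0E.
by rewrite mderivX mnm1E eq_sym (negPf ji) scale0r mulr0.
Qed.

Lemma in_quadratic_ind (S : {pred quadric k}) : subalg_closed S ->
  (forall i j : 'I_3, X i * X j \in S) -> forall z, in_quadratic z -> z \in S.
Proof. by move=> SS XS z /asboolP; apply. Qed.

Lemma quadratic_ind (S : {pred quadratic k}) : subalg_closed S ->
  (forall i j : 'I_3, xmon k i j \in S) -> forall z, z \in S.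
Proof.
move=> [S1 SL SM] XS z.
suff : val z \in [pred w | `[< exists2 y, y \in S & val y = w >]].
  by move=> /asboolP[y yS /val_inj <-].
apply: in_quadratic_ind (valP z); last first.
  by move=> i j; apply/asboolP; exists (xmon k i j).
split; first by apply/asboolP; exists 1.
  move=> c u v /asboolP[a aS <-] /asboolP[b bS <-]; apply/asboolP.
  by exists (c *: a + b); first exact: SL.
move=> u v /asboolP[a aS <-] /asboolP[b bS <-]; apply/asboolP.
by exists (a * b); first exact: SM.
Qed.

(** By the Leibniz rule it suffices to look at the generators. *)
Lemma quadratic_derivation (d : quadric k -> quadric k) : derivation d ->
    (forall i j, in_quadratic (d (X i) * X j)) ->
  exists2 D : quadratic k -> quadratic k, derivation D & forall z, val (D z) = d (val z).
Proof.
move=> derd dX.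
have stable z : in_quadratic z -> in_quadratic (d z).
  move=> zQ; suff : z \in [pred w | (w \in @in_quadratic k) && (d w \in @in_quadratic k)].
    by case/andP.
  apply: in_quadratic_ind zQ.
    split; first by rewrite inE (derivation1 derd) rpred1 rpred0.
      move=> c u v /andP[uQ duQ] /andP[vQ dvQ]; rewrite inE (derivationP derd).
      by rewrite !rpredD ?rpredZ.
    move=> u v /andP[uQ duQ] /andP[vQ dvQ]; rewrite inE (derivationM derd).
    by rewrite rpredD ?rpredM.
  move=> i j; rewrite inE (derivationM derd) [X i * d _]mulrC.
  by apply/andP; split; [exact: quadratic_monomial_subproof|apply: rpredD; exact: dX].
pose D (z : quadratic k) : quadratic k := Quadratic (stable _ (valP z)).
exists D => //; split=> [c|] u v; apply/val_inj => /=.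
  exact: (derivationP derd).
exact: (derivationM derd).
Qed.

Lemma quadric_locally_nilpotent (d : quadric k -> quadric k) : derivation d ->
  (forall i, exists n, iter n d (X i) = 0) -> locally_nilpotent d.
Proof.
move=> derd nX z; have sub := locally_nilpotent_subalg derd char0.
apply/asboolP; apply: (QuadraticOX.quadric_ind sub) => j.
by apply/asboolP; exact: nX.
Qed.

Lemma quadratic_locally_nilpotent (d : quadric k -> quadric k)
    (D : quadratic k -> quadratic k) : (forall z, val (D z) = d (val z)) ->
  locally_nilpotent d -> locally_nilpotent D.
Proof.
move=> Dd nild z; have [n dn] := nild (val z); exists n; apply/val_inj.
by rewrite -[RHS]dn; elim: {dn} n => //= n <-; rewrite Dd.
Qed.

Lemma ord3P (P : 'I_3 -> Prop) : P i0 -> P i1 -> P i2 -> forall i, P i.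
Proof.
move=> h0 h1 h2 [[|[|[|//]]] hi].
- by rewrite (_ : Ordinal hi = i0) //; apply/val_inj.
- by rewrite (_ : Ordinal hi = i1) //; apply/val_inj.
by rewrite (_ : Ordinal hi = i2) //; apply/val_inj.
Qed.

Lemma sum_ord3 (V : nmodType) (f : 'I_3 -> V) : \sum_i f i = f i0 + f i1 + f i2.
Proof.
rewrite !big_ord_recl big_ord0 addr0 addrA.
by congr (f _ + f _ + f _); apply/val_inj.
Qed.

Lemma mderiv_quadric_eq :
  [/\ mderiv i0 (quadric_eq k) = 2 * 'X_i2, mderiv i1 (quadric_eq k) = - (2 * 'X_i1)
    & mderiv i2 (quadric_eq k) = 2 * 'X_i0].
Proof.
have dX i j : mderiv i ('X_j : {mpoly k[3]}) = (i == j)%:R.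
  rewrite mderivX mnm1E eq_sym; case: eqP => [->|_]; last by rewrite scale0r.
  by rewrite scale1r -mpolyX0; congr mpolyX; apply/mnmP => l; rewrite mnmBE subnn mnm0E.
have d2 i : mderiv i (2 : {mpoly k[3]}) = 0 by rewrite -mpolyC_nat mderivC.
have d1 i : mderiv i (1 : {mpoly k[3]}) = 0 by rewrite -mpolyC1 mderivC.
by split; rewrite /quadric_eq expr2 !mderivB !mderivM d2 d1 !dX /=; ring.
Qed.

(** The opposite unipotent subgroups of [SL_2] act on the quadric through the
vector fields [x2 -> x1 -> x0 -> 0] and [x0 -> x1 -> x2 -> 0]. *)
Definition down_field (i : 'I_3) : {mpoly k[3]} :=
  if i == i0 then 0 else if i == i1 then 'X_i0 else 'X_i1.
Definition up_field (i : 'I_3) : {mpoly k[3]} :=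
  if i == i0 then 'X_i1 else if i == i1 then 'X_i2 else 0.

Lemma down_derivation : exists D : quadric k -> quadric k,
  [/\ derivation D, D (X i0) = 0, D (X i1) = X i0 & D (X i2) = X i1].
Proof.
have [|D derD DE] := quadric_derivation (v := down_field).
  have [e0 e1 e2] := mderiv_quadric_eq.
  by rewrite sum_ord3 e0 e1 e2 /down_field /=; ring.
by exists D; split=> //; rewrite DE /down_field /= ?rmorph0.
Qed.

Lemma up_derivation : exists D : quadric k -> quadric k,
  [/\ derivation D, D (X i2) = 0, D (X i1) = X i2 & D (X i0) = X i1].
Proof.
have [|D derD DE] := quadric_derivation (v := up_field).
  have [e0 e1 e2] := mderiv_quadric_eq.
  by rewrite sum_ord3 e0 e1 e2 /up_field /=; ring.
by exists D; split=> //; rewrite DE /up_field /= ?rmorph0.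
Qed.

Lemma quadric_relation : X i1 * X i1 = 2 * (X i0 * X i2) - 1.
Proof.
apply/eqP; rewrite -subr_eq0 -oppr_eq0; apply/eqP.
transitivity (pi (quadric_eq k)); last by apply/quotalg_pi_eq0; exists 1; rewrite mul1r.
by rewrite /quadric_eq !rmorphB !rmorphM rmorph1 rmorph_nat -!/(xvar k _); ring.
Qed.
End QuadricDerivations.

(** * The isomorphism of cylinders *)

Lemma slice_identity (A : comNzRingType) (x00 x01 x02 x11 x12 x22 : A) :
    x00 * x22 = x02 * x02 -> x01 * x12 = x02 * x11 -> x11 = 2 * x02 - 1 ->
  15 * x00 * x22 - (3 * x00 * x22 + 3 * x01 * (2 * x12)) - 2 * (x02 + x11) = 2.
Proof.
move=> e22 e02 rel.
transitivity (12 * (x00 * x22) - 6 * (x01 * x12) - 2 * x02 - 2 * x11); first by ring.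
by rewrite e22 e02 rel; ring.
Qed.

Section Cylinders.
Variable k : closedFieldType.
Hypothesis char0 : [pchar k] =i pred0.

Local Notation X := (xvar k).
Local Notation x i j := (xmon k i j).

Lemma quadratic_derivation_nilpotent (d : quadric k -> quadric k) : derivation d ->
    (forall i j, in_quadratic (d (X i) * X j)) ->
    (forall i, exists n, iter n d (X i) = 0) ->
  exists D : quadratic k -> quadratic k, [/\ derivation D, locally_nilpotent D &
    forall i j, val (D (x i j)) = d (X i) * X j + X i * d (X j)].
Proof.
move=> derd dX nild; have [D derD DE] := quadratic_derivation derd dX.
exists D; split=> // [|i j].
  exact: (quadratic_locally_nilpotent DE (quadric_locally_nilpotent char0 derd nild)).
by rewrite DE (derivationM derd).
Qed.

Lemma quadratic_down : exists D : quadratic k -> quadratic k,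
  [/\ derivation D, locally_nilpotent D &
   [/\ D (x i0 i0) = 0, D (x i0 i1) = x i0 i0, D (x i1 i1) = 2 * x i0 i1,
       D (x i1 i2) = x i0 i2 + x i1 i1 & D (x i2 i2) = 2 * x i1 i2]].
Proof.
have [d [derd d0 d1 d2]] := down_derivation k.
have [||D [derD nilD DE]] := quadratic_derivation_nilpotent derd.
- move=> i j; elim/ord3P: i; rewrite ?d0 ?d1 ?d2.
  + by rewrite mul0r -[in_quadratic _]/(0 \in @in_quadratic k) rpred0.
  + exact: quadratic_monomial_subproof.
  + exact: quadratic_monomial_subproof.
- elim/ord3P; [exists 1%N|exists 2%N|exists 3%N]; by rewrite /= ?d2 ?d1 ?d0.
exists D; split=> //.
split; apply/val_inj; rewrite DE ?d0 ?d1 ?d2.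
- by rewrite mul0r mulr0 addr0.
- by rewrite mul0r add0r.
- by rewrite [RHS](rmorphM val) rmorph_nat /=; ring.
- by rewrite [RHS](rmorphD val) /=.
- by rewrite [RHS](rmorphM val) rmorph_nat /=; ring.
Qed.

Lemma quadratic_up : exists D : quadratic k -> quadratic k,
  [/\ derivation D, locally_nilpotent D & D (x i0 i0) = 2 * x i0 i1].
Proof.
have [d [derd d2 d1 d0]] := up_derivation k.
have [||D [derD nilD DE]] := quadratic_derivation_nilpotent derd.
- move=> i j; elim/ord3P: i; rewrite ?d0 ?d1 ?d2.
  + exact: quadratic_monomial_subproof.
  + exact: quadratic_monomial_subproof.
  + by rewrite mul0r -[in_quadratic _]/(0 \in @in_quadratic k) rpred0.
- elim/ord3P; [exists 3%N|exists 2%N|exists 1%N]; by rewrite /= ?d0 ?d1 ?d2.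
exists D; split=> //; apply/val_inj; rewrite DE d0.
by rewrite [RHS](rmorphM val) rmorph_nat /=; ring.
Qed.

Lemma quadratic_relation : x i1 i1 = 2 * x i0 i2 - 1.
Proof.
apply/val_inj; rewrite [RHS](rmorphB val) rmorphM rmorph_nat rmorph1 /=.
exact: quadric_relation.
Qed.

Lemma quadratic_mul i j l m : x i j * x l m = x i l * x j m.
Proof. by apply/val_inj => /=; exact: mulrACA. Qed.

(** Put [x = x0] and [y = x1].  The polynomial [F] is twice the difference
quotient [(y - y') / x], where [y' = (3 y^5 + 10 y^3 + 15 y) / 8
- 15 / 2 * x^3 T].  The derivation below kills [x] and [y'] and sends [y] to [x],
which determines its value [x2 ^ 2] at [T]. *)
Lemma F_slice (D : quadratic k -> quadratic k) : derivation D ->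
    [/\ D (x i0 i0) = 0, D (x i0 i1) = x i0 i0, D (x i1 i1) = 2 * x i0 i1,
       D (x i1 i2) = x i0 i2 + x i1 i1 & D (x i2 i2) = 2 * x i1 i2] ->
  poly_derivation D (x i2 i2) (F k) = 2.
Proof.
move=> derD [d00 d01 d11 d12 d22].
have derDelta := derivation_poly_derivation (x i2 i2) derD.
have -> : F k = (15 * x i0 i0)%:P * 'X - (3 * x i0 i1 * x i2 i2)%:P
  - (2 * x i1 i2)%:P by [].
rewrite !(derivationB derDelta) (derivationM derDelta).
rewrite !(poly_derivationC _ derD) (poly_derivationX _ derD).
rewrite !(derivationM derD) !(derivation_nat derD) d00 d01 d12 d22.
have e02 : x i0 i1 * x i1 i2 = x i0 i2 * x i1 i1.
  by apply/val_inj => /=; ring.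
have e22 : x i0 i0 * x i2 i2 = x i0 i2 * x i0 i2 by rewrite quadratic_mul.
rewrite mul0r mulr0 addr0 polyC0 mul0r add0r -polyCM -!polyCB -polyC_natr.
rewrite !mul0r !add0r; congr polyC; exact: slice_identity e22 e02 quadratic_relation.
Qed.

Lemma quadratic_cylinder : alg_isomorphic (polyalg (quadratic k)) (polyalg (Rtilde k)).
Proof.
have [D [derD nilD values]] := quadratic_down.
have derDelta := derivation_poly_derivation (x i2 i2) derD.
have nilDelta := poly_derivation_nilpotent (x i2 i2) derD char0 nilD.
have n2 : (2 : k) != 0 by have /pcharf0P -> := char0.
pose s : polyalg (quadratic k) := 2^-1 *: (F k : polyalg (quadratic k)).
have s1 : poly_derivation D (x i2 i2) s = 1.
  rewrite /s (derivationZ derDelta) F_slice // -scaler_nat scalerA mulVf ?scale1r //.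
apply: (slice_theorem char0 derDelta nilDelta s1
  (pi := quotalg_pi (principal_ideal (@F_nonunit k)))).
  exact: quotalg_pi_surj.
move=> a; rewrite quotalg_pi_eq0 /s; split=> -[b ->].
  by exists (2 *: b); rewrite -scalerAl -scalerAr scalerA mulfV // scale1r.
by exists (2^-1 *: b); rewrite -scalerAr -scalerAl.
Qed.
End Cylinders.

(** * The function field of the quadric *)

Section FunctionField.
Variables (k : closedFieldType) (char0 : [pchar k] =i pred0).
Variables (K : fieldType) (iota : {rmorphism {poly {poly k}} -> K}).
Hypothesis iota_inj : injective iota.

Local Notation X := (xvar k).

Definition fconst : {rmorphism k -> K} := iota \o (polyC \o polyC).
Definition fx : K := iota 'X.
Definition fy : K := iota ('X)%:P.

(** The coordinates of the generic point of the quadric. *)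
Definition fcoord (i : 'I_3) : K :=
  if i == i0 then fx else if i == i1 then fy else (fy ^+ 2 + 1) / (2 * fx).

Lemma fnat_neq0 n : (n.+1%:R : K) != 0.
Proof.
rewrite -(rmorph_nat fconst) fmorph_eq0; have /pcharf0P -> := char0; by [].
Qed.

Lemma fx_neq0 : fx != 0.
Proof. by rewrite /fx -(rmorph0 iota) (inj_eq iota_inj) polyX_eq0. Qed.

Lemma fy_neq0 : fy != 0.
Proof. by rewrite /fy -(rmorph0 iota) (inj_eq iota_inj) polyC_eq0 polyX_eq0. Qed.

(** Elements of [K] that are Laurent polynomials in the first variable can be
evaluated at the points where that variable does not vanish. *)
Definition specializes (u s : k) (a : K) (c : k) :=
  exists N (q : {poly {poly k}}), a * fx ^+ N = iota q /\ c * u ^+ N = q.[u%:P].[s].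

Section Specialization.
Variables (u s : k).
Hypothesis u0 : u != 0.

Lemma specializesD a b c d : specializes u s a c -> specializes u s b d ->
  specializes u s (a + b) (c + d).
Proof.
move=> [N [q [qa qc]]] [M [r [ra rc]]]; exists (N + M)%N, (q * 'X^M + 'X^N * r).
split.
  by rewrite rmorphD !rmorphM !rmorphXn /= -qa -ra -/fx exprD; ring.
rewrite !(hornerD, hornerM, hornerXn) -!polyC_exp !(hornerD, hornerM, hornerC).
by rewrite -qc -rc exprD; ring.
Qed.

Lemma specializesM a b c d : specializes u s a c -> specializes u s b d ->
  specializes u s (a * b) (c * d).
Proof.
move=> [N [q [qa qc]]] [M [r [ra rc]]]; exists (N + M)%N, (q * r).
rewrite !hornerM -qc -rc rmorphM /= -qa -ra.
by split; rewrite exprD; ring.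
Qed.

Lemma specializes_const c : specializes u s (fconst c) c.
Proof. by exists 0%N, c%:P%:P; rewrite !expr0 !mulr1 !hornerC. Qed.

Lemma specializes0 c : specializes u s 0 c -> c = 0.
Proof.
move=> [N [q [+ qc]]]; rewrite mul0r -[LHS](rmorph0 iota) => /iota_inj q0.
move: qc; rewrite -q0 !horner0 => /eqP; rewrite mulf_eq0 expf_eq0 (negPf u0) andbF orbF.
by move/eqP.
Qed.

Lemma specializes_coord v i : 2 * u * v - s * s = 1 ->
  specializes u s (fcoord i) (if i == i0 then u else if i == i1 then s else v).
Proof.
move=> rel; rewrite /fcoord; case: ifP => _; [|case: ifP => _].
- by exists 0%N, 'X; rewrite !expr0 !mulr1 hornerX hornerC.
- by exists 0%N, ('X)%:P; rewrite !expr0 !mulr1 hornerC hornerX.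
have n2 : (2 : k) != 0 by have /pcharf0P -> := char0.
exists 1%N, ((2^-1 : k)%:P%:P * (('X)%:P ^+ 2 + 1)); split; last first.
  rewrite !hornerE /= ?hornerE /=.
  have -> : s ^+ 2 + 1 = 2 * u * v by apply/esym/eqP; rewrite addrC -subr_eq expr2 rel.
  by field.
rewrite rmorphM rmorphD rmorph1 rmorphXn /= -/fy.
rewrite -[iota _]/(fconst 2^-1) fmorphV rmorph_nat.
by have n2' := fnat_neq0 1; have x0 := fx_neq0; field; rewrite n2' x0.
Qed.
End Specialization.

(** The points with [x0 != 0] are dense: in the normal form [q0 + x1 q1], with
[q0] and [q1] polynomials in [x0] and [x2], changing the sign of [x1] at such a
point separates [q0] from [q1]. *)
Lemma quadric_point_density (i : k) (ii : i * i = -1) (z : quadric k) :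
  (forall g : SL2 k, QuadraticOX.pt i (val g) i0 != 0 -> QuadraticOX.psi ii z g = 0) ->
  z = 0.
Proof.
have [q0 [q1 ->]] := QuadraticOX.normal z => z0.
have n2 : (2 : k) != 0 by have /pcharf0P -> := char0.
have key (u v : k) : u * q0.[u%:P].[v] = 0 /\ u * (2 * u * v - 1) * q1.[u%:P].[v] = 0.
  have [->|u0] := eqVneq u 0; first by rewrite !mul0r.
  have [s ss] := QuadraticOX.sqr_ex (2 * u * v - 1).
  have aux t : t * t = 2 * u * v - 1 -> q0.[u%:P].[v] + t * q1.[u%:P].[v] = 0.
    move=> tt; have [|g [g0 g1 g2]] := QuadraticOX.pt_onto char0 ii (v0 := u) (v1 := t) (v2 := v).
      by rewrite tt; ring.
    have := z0 g; rewrite g0 => /(_ u0); rewrite rmorphD rmorphM.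
    rewrite -[LHS]/(QuadraticOX.psi ii (QuadraticOX.J k q0) g
      + QuadraticOX.psi ii (X i1) g * QuadraticOX.psi ii (QuadraticOX.J k q1) g).
    by rewrite !QuadraticOX.psiJ QuadraticOX.psi_var g0 g1 g2.
  have e1 := aux s ss.
  have e2 : q0.[u%:P].[v] + (- s) * q1.[u%:P].[v] = 0 by apply: aux; rewrite mulrNN.
  have Q0 : q0.[u%:P].[v] = 0.
    by apply: (mulfI n2); rewrite mulr0 -[RHS]addr0 -{1}e1 -e2; ring.
  split; first by rewrite Q0 mulr0.
  by move: e1; rewrite Q0 add0r -ss => e1; rewrite -2!mulrA e1 !mulr0.
have -> : q0 = 0.
  have : 'X * q0 = 0.
    by apply: (QuadraticOX.poly2_inf char0) => u v; rewrite !hornerE; case: (key u v).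
  by move/eqP; rewrite mulf_eq0 polyX_eq0 => /eqP.
suff -> : q1 = 0 by rewrite !rmorph0 mulr0 addr0.
have : 'X * (2 * 'X * ('X)%:P - 1) * q1 = 0.
  apply: (QuadraticOX.poly2_inf char0) => u v; case: (key u v) => _ <-.
  by rewrite !hornerE /=; ring.
move/eqP; rewrite !mulf_eq0 polyX_eq0 => /orP[|/eqP//].
move/eqP/(congr1 (fun q => q.[0].[0])); rewrite !hornerE /= => /eqP.
by rewrite ?(mulr0, mul0r, sub0r) oppr_eq0 oner_eq0.
Qed.

Lemma quadric_embedding : exists rho : {rmorphism quadric k -> K},
  [/\ injective rho, forall c, rho c%:A = fconst c & forall i, rho (X i) = fcoord i].
Proof.
pose f : {rmorphism {mpoly k[3]} -> K} := mmap fconst fcoord.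
have fX i : f 'X_i = fcoord i by rewrite /f /= mmapX mmap1U.
have n2 := fnat_neq0 1; have x0 := fx_neq0.
have f0 a : a \in principal_ideal (@quadric_eq_nonunit k) -> f a = 0.
  move=> /asboolP[b ->]; rewrite rmorphM /quadric_eq expr2 !rmorphB !rmorphM rmorph1.
  rewrite rmorph_nat !fX /fcoord /=.
  have -> : 2 * fx * ((fy ^+ 2 + 1) / (2 * fx)) - fy * fy - 1 = 0; last by rewrite mulr0.
  by field; rewrite n2 x0.
pose rho : {rmorphism quadric k -> K} := quotalg_lift f0.
have rhoE a : rho (quotalg_pi (principal_ideal (@quadric_eq_nonunit k)) a) = f a.
  exact: quotalg_liftE.
have rhoX i : rho (X i) = fcoord i by rewrite rhoE fX.
have rhoC c : rho c%:A = fconst c.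
  have -> : c%:A = quotalg_pi (principal_ideal (@quadric_eq_nonunit k)) c%:A.
    by rewrite linearZ rmorph1.
  by rewrite rhoE /f /= mmapZ rmorph1 mulr1.
exists rho; split=> //.
suff ker z : rho z = 0 -> z = 0.
  by move=> a b ab; apply/subr0_eq/ker; rewrite rmorphB ab subrr.
move=> rz; have [i] := ex_sqrtN1 k; rewrite expr2 => ii.
refine (quadric_point_density (ii:=ii) _) => g u0.
set u := QuadraticOX.pt i (val g) i0 in u0.
pose s := QuadraticOX.pt i (val g) i1.
suff : specializes u s (rho z) (QuadraticOX.psi ii z g).
  by rewrite rz; apply: specializes0.
have rel : 2 * u * QuadraticOX.pt i (val g) i2 - s * s = 1.
  have /(congr1 (fun w => QuadraticOX.psi ii w g)) := quadric_relation k.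
  rewrite rmorphB !rmorphM rmorph_nat rmorph1 => e.
  have {e} : QuadraticOX.psi ii (X i1) g * QuadraticOX.psi ii (X i1) g =
    2 * (QuadraticOX.psi ii (X i0) g * QuadraticOX.psi ii (X i2) g) - 1 by exact: e.
  by rewrite !QuadraticOX.psi_var => e; rewrite /s e /u; ring.
suff : z \in [pred z | `[< specializes u s (rho z) (QuadraticOX.psi ii z g) >]].
  by move/asboolP.
have sub := specializes_const u s.
apply: QuadraticOX.quadric_ind => [|j].
  split; first by apply/asboolP; rewrite !rmorph1 -(rmorph1 fconst); exact: sub.
    move=> c a b /asboolP ha /asboolP hb; apply/asboolP.
    have -> : QuadraticOX.psi ii (c *: a + b) g =
        c * QuadraticOX.psi ii a g + QuadraticOX.psi ii b g.
      by rewrite rmorphD /= QuadraticOX.psiZ.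
    rewrite -[c *: a]mul1r -scalerAr scalerAl rmorphD rmorphM rhoC.
    by apply: specializesD => //; apply: specializesM.
  move=> a b /asboolP ha /asboolP hb; apply/asboolP; rewrite !rmorphM.
  exact: specializesM ha hb.
apply/asboolP; rewrite rhoX QuadraticOX.psi_var.
have := specializes_coord j rel; move: j; apply: ord3P => //=.
Qed.
End FunctionField.

(** * The embedding of Rtilde in the function field *)

(** The polynomial ring over [B] is one over [A], hence embeds in [{poly K}]. *)
Lemma cylinder_domain (k : fieldType) (A B : comAlgType k) (K : fieldType)
    (r : {rmorphism A -> K}) : injective r ->
    alg_isomorphic (polyalg A) (polyalg B) ->
  forall a b : B, a * b = 0 -> a = 0 \/ b = 0.
Proof.
move=> rI [f [g fK gK]] a b ab.
have rP : injective (map_poly r).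
  by move=> p q e; apply/polyP => i; apply: rI; rewrite -!coef_map e.
have gf0 (q : polyalg B) : g q = 0 -> q = 0 by move=> q0; rewrite -[q]gK q0 rmorph0.
have : (map_poly r (g a%:P) * map_poly r (g b%:P)) = 0.
  rewrite -rmorphM -(rmorph0 (map_poly r)); congr (map_poly r _).
  apply: (can_inj fK); rewrite rmorphM rmorph0 /= !gK.
  by rewrite -[LHS](polyCM a b) ab.
move=> /eqP; rewrite mulf_eq0 => /orP[] /eqP e; [left|right]; apply/polyC_inj/gf0;
  by apply: rP; rewrite rmorph0.
Qed.

(** Modulo the linear polynomial, multiplying by a power of its leading
coefficient brings any class into the image of [A], where evaluation is known to be
injective; when the quotient is a domain, that power can be cancelled. *)
Lemma linear_quotient_embedding (A B : comNzRingType) (K : fieldType)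
    (pi : {rmorphism {poly A} -> B}) (r : {rmorphism A -> K}) (a n : A) :
    (forall b, exists p, pi p = b) ->
    (forall p, pi p = 0 <-> exists q, p = q * (a%:P * 'X - n%:P)) ->
    (forall b c : B, b * c = 0 -> b = 0 \/ c = 0) ->
    injective r -> r a != 0 ->
  exists rho : {rmorphism B -> K}, [/\ injective rho,
    forall c, rho (pi c%:P) = r c & rho (pi 'X) = r n / r a].
Proof.
move=> surj kerpi dom rI ra.
have comm : commr_rmorph r (r n / r a) by move=> ?; exact: mulrC.
pose e : {rmorphism {poly A} -> K} := horner_morph comm.
have eC c : e c%:P = r c by exact: horner_morphC.
have eX : e 'X = r n / r a by exact: horner_morphX.
have e0 p : pi p = 0 -> e p = 0.
  move=> /kerpi[q ->]; rewrite rmorphM rmorphB rmorphM !eC eX.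
  by rewrite mulrC mulrA [_ * r n]mulrC mulfK // subrr mul0r.
have surj' b : exists p, pi p == b by have [p <-] := surj b; exists p.
pose h b := e (xchoose (surj' b)).
have hE p : h (pi p) = e p.
  apply/subr0_eq; rewrite -rmorphB; apply: e0.
  by rewrite rmorphB; apply/eqP; rewrite subr_eq0 (xchooseP (surj' (pi p))).
have zm : zmod_morphism h.
  move=> b c; have [p <-] := surj b; have [q <-] := surj c.
  by rewrite -rmorphB !hE rmorphB.
have mm : monoid_morphism h.
  split=> [|b c]; first by rewrite -(rmorph1 pi) hE rmorph1.
  by have [p <-] := surj b; have [q <-] := surj c; rewrite -rmorphM !hE rmorphM.
pose rho : {rmorphism B -> K} := HB.pack h
  (GRing.isZmodMorphism.Build B K h zm) (GRing.isMonoidMorphism.Build B K h mm).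
have rhoE p : rho (pi p) = e p by exact: hE.
have aX : pi a%:P * pi 'X = pi n%:P.
  apply/subr0_eq; rewrite -rmorphM -rmorphB.
  by apply/kerpi; exists 1; rewrite mul1r.
(* Multiplying by powers of [a] clears the variable. *)
have clear b : exists m c, pi a%:P ^+ m * b = pi c%:P.
  have [p <-] := surj b; elim/poly_ind: p => [|p c [m [d IH]]].
    by exists 0%N, 0; rewrite expr0 mul1r polyC0.
  exists m.+1, (d * n + a ^+ m.+1 * c).
  rewrite rmorphD rmorphM polyCD !polyCM polyC_exp rmorphD !rmorphM rmorphXn.
  rewrite mulrDr; congr (_ + _); rewrite -IH -aX exprS; ring.
exists rho; split=> [|c|]; [|by rewrite rhoE|by rewrite rhoE].
suff ker b : rho b = 0 -> b = 0.
  by move=> b c bc; apply/subr0_eq/ker; rewrite rmorphB bc subrr.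
move=> b0; have [m [c mc]] := clear b.
have : rho (pi c%:P) = 0 by rewrite -mc rmorphM b0 mulr0.
rewrite rhoE eC -(rmorph0 r) => /rI c0.
elim: m mc => [|m IH]; first by rewrite expr0 mul1r c0 polyC0 rmorph0.
rewrite c0 polyC0 rmorph0 exprS -mulrA => /dom[pa0|pa0]; last by apply: IH; rewrite c0 polyC0 rmorph0.
have : rho (pi a%:P) = 0 by rewrite pa0 rmorph0.
by rewrite rhoE eC => /eqP; rewrite (negPf ra).
Qed.

Lemma subalg_closed_preim (k : fieldType) (A B : comAlgType k) (f : {rmorphism A -> B})
    (S : {pred B}) : (forall c a, f (c *: a) = c *: f a) ->
  subalg_closed S -> subalg_closed [pred a | f a \in S].
Proof.
move=> fZ [S1 SL SM]; split; first by rewrite inE rmorph1.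
  by move=> c u v uS vS; rewrite inE rmorphD fZ; apply: SL.
by move=> u v uS vS; rewrite inE rmorphM; apply: SM.
Qed.

Lemma poly_subalg_ind (k : fieldType) (A B : comAlgType k) (f : {rmorphism {poly A} -> B})
    (S : {pred B}) : subalg_closed S -> (forall a, f a%:P \in S) -> f 'X \in S ->
  forall p, f p \in S.
Proof.
move=> [S1 SL SM] SC SX p.
elim/poly_ind: p => [|p c pS]; first by rewrite -polyC0.
by rewrite rmorphD rmorphM -[_ * _]scale1r; apply: (SL _ _ _ _ (SC c)); apply: SM.
Qed.

Section RtildeEmbedding.
Variables (k : closedFieldType) (char0 : [pchar k] =i pred0).
Variables (K : fieldType) (iota : {rmorphism {poly {poly k}} -> K}).
Hypothesis iota_inj : injective iota.

Local Notation fx := (fx iota).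
Local Notation fy := (fy iota).
Local Notation R := (quadratic k).

Definition Rt_pi : {rmorphism {poly R} -> Rtilde k} :=
  quotalg_pi (principal_ideal (@F_nonunit k)).
Definition Rt_const : {rmorphism R -> Rtilde k} := Rt_pi \o polyC.
Definition Rt_mon (i j : 'I_3) : Rtilde k := Rt_const (xmon k i j).
Definition Rt_var : Rtilde k := Rt_pi 'X.

(** The value of [T] forced by the equation [F = 0] at the generic point. *)
Definition ft : K := fy * (fy ^+ 2 + 1) * (3 * fy ^+ 2 + 7) / (60 * fx ^+ 3).

Lemma Rt_pi_eq0 a : Rt_pi a = 0 <-> exists b, a = b * F k.
Proof. exact: quotalg_pi_eq0. Qed.

Lemma Rt_pi_surj a : exists p, Rt_pi p = a.
Proof. exact: (@quotalg_pi_surj _ (polyalg R) _ (@F_nonunit k) a). Qed.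

Lemma Rt_constZ c (z : R) : Rt_const (c *: z) = c *: Rt_const z.
Proof.
rewrite -[RHS]/(Rt_pi ((c%:A)%:P * 1) * Rt_pi z%:P) mulr1.
by rewrite -rmorphM -polyCM -scalerAl mul1r.
Qed.

Lemma Rtilde_ind (S : {pred Rtilde k}) : subalg_closed S ->
  (forall i j, Rt_mon i j \in S) -> Rt_var \in S -> forall a, a \in S.
Proof.
move=> SS Smon Svar a; have [p <-] := Rt_pi_surj a.
apply: poly_subalg_ind => // z.
exact: (quadratic_ind (subalg_closed_preim Rt_constZ SS) Smon).
Qed.

Lemma Rtilde_embedding : exists rho : {rmorphism Rtilde k -> K},
  [/\ injective rho, forall c, rho c%:A = fconst iota c,
    forall i j, rho (Rt_mon i j) = fcoord iota i * fcoord iota j & rho Rt_var = ft].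
Proof.
have [rho0 [rho0I rho0C rho0X]] := quadric_embedding char0 iota_inj.
pose r : {rmorphism R -> K} := rho0 \o val.
have rI : injective r by exact: inj_comp rho0I val_inj.
have rmon i j : r (xmon k i j) = fcoord iota i * fcoord iota j.
  by rewrite -!rho0X -rmorphM.
have rC c : r c%:A = fconst iota c by exact: rho0C.
have dom := cylinder_domain rI (quadratic_cylinder char0).
have nat0 := fnat_neq0 char0 iota; have x0 := fx_neq0 iota_inj.
pose a : R := 15 * xmon k i0 i0.
pose n : R := 3 * xmon k i0 i1 * xmon k i2 i2 + 2 * xmon k i1 i2.
have ra : r a = 15 * fx ^+ 2 by rewrite rmorphM rmorph_nat rmon.
have ra0 : r a != 0 by rewrite ra mulf_neq0 ?expf_neq0 ?(nat0 14%N).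
have kerpi p : Rt_pi p = 0 <-> exists q, p = q * (a%:P * 'X - n%:P).
  by rewrite Rt_pi_eq0 /F polyCD opprD addrA.
have [rho [rhoI rhoC rhoX]] := linear_quotient_embedding Rt_pi_surj kerpi dom rI ra0.
exists rho; split=> // [c|i j|].
- have -> : c%:A = Rt_const c%:A by rewrite Rt_constZ rmorph1.
  by rewrite [LHS]rhoC rC.
- by rewrite [LHS]rhoC rmon.
rewrite [LHS]rhoX ra rmorphD !rmorphM !rmorph_nat !rmon /ft /fcoord /=.
have n2 := nat0 1%N; have n15 := nat0 14%N; have n60 := nat0 59%N.
by field; rewrite n2 n15 n60 x0.
Qed.
End RtildeEmbedding.

(** * Polynomial solutions of cubic equations *)

Section PolynomialIdentities.
Variable (D : idomainType).
Hypothesis char0 : [pchar D] =i pred0.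

Lemma natD_neq0 n : (n.+1%:R : D) != 0.
Proof. by have /pcharf0P -> := char0. Qed.

Lemma natP_neq0 n : (n.+1%:R : {poly D}) != 0.
Proof. by rewrite -polyC_natr polyC_eq0 natD_neq0. Qed.

(** A derivative is too short to be a nonzero multiple of the polynomial. *)
Lemma deriv_multiple_eq0 (q r : {poly D}) : q^`() = q * r -> q^`() = 0.
Proof.
move=> e; have [q0|q0] := eqVneq q 0; first by rewrite q0 deriv0.
have [r0|r0] := eqVneq r 0; first by rewrite e r0 mulr0.
have := lt_size_deriv q0; rewrite e size_mul //.
have : (0 < size r)%N by rewrite lt0n size_poly_eq0.
by move: (size q) (size r) => n [//|m] _; rewrite addnS /= ltnNge leq_addr.
Qed.

Lemma deriv_eq0_const (q : {poly D}) : q^`() = 0 -> q = (q`_0)%:P.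
Proof.
move=> q0; apply/polyP => -[|n]; rewrite coefC //=.
have /(congr1 (fun p : {poly D} => p`_n)) := q0.
rewrite coef_deriv coef0 -mulr_natr => /eqP.
by rewrite mulf_eq0 (negPf (natD_neq0 n)) orbF => /eqP.
Qed.

(** For a nonconstant solution the degrees of [om] and [xi] would be in the ratio
5 to 2, although [om] divides [xi'] because it is prime to [5 pi - 2]: this is the
argument of Mason and Stothers for [c x^3 = y^2 + 1], an affine curve of genus one,
which has no polynomial parametrization. *)
Lemma cusp_rigidity (c : D) (xi pi om : {poly D}) : c != 0 -> xi != 0 ->
  pi ^+ 2 = c%:P ^+ 2 * xi ^+ 3 -> om ^+ 2 = xi * (pi - 1) -> xi^`() = 0.
Proof.
move=> c0 xi0 e1 e2; apply/eqP/negPn/negP => dxi0.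
have cP0 : c%:P != 0 by rewrite polyC_eq0.
have xiS : (1 < size xi)%N.
  rewrite ltnNge; apply: contra dxi0 => /size1_polyC ->.
  by rewrite derivC.
have pi0 : pi != 0.
  apply: contraNneq xi0 => p0; move/eqP: e1; rewrite p0 expr0n /= eq_sym.
  by rewrite mulf_eq0 !expf_eq0 (negPf cP0) /=.
have d1 : 2 * pi^`() * xi = 3 * xi^`() * pi.
  apply: (mulfI pi0); apply: (mulfI xi0).
  have /(congr1 (@deriv _)) := e1.
  rewrite !exprS !expr0 !derivM derivC => d.
  transitivity (xi ^+ 2 * (pi^`() * (pi * 1) + pi * (pi^`() * 1 + pi * 1^`()))).
    by rewrite derivC; ring.
  rewrite d derivC.
  transitivity (3 * xi^`() * xi * (c%:P ^+ 2 * xi ^+ 3)); first by ring.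
  by rewrite -e1; ring.
have d2 : 4 * om * om^`() = xi^`() * (5 * pi - 2).
  have /(congr1 (@deriv _)) := e2.
  rewrite expr2 !derivM derivB derivC => d.
  transitivity (2 * (om^`() * om + om * om^`())); first by ring.
  rewrite d; transitivity (2 * xi^`() * (pi - 1) + 2 * pi^`() * xi); first by ring.
  by rewrite d1; ring.
(* Modulo [5 pi - 2] the polynomial [c ^ 2 om ^ 6 = pi ^ 2 (pi - 1) ^ 3] is the
   nonzero constant [- 108 / 3125]. *)
pose s := 625 * pi ^+ 4 - 1625 * pi ^+ 3 + 1225 * pi ^+ 2 - 135 * pi - 54.
have bezout : 3125 * c%:P ^+ 2 * om ^+ 6 + 108 = (5 * pi - 2) * s.
  have -> : om ^+ 6 = (om ^+ 2) ^+ 3 by ring.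
  rewrite e2; transitivity (3125 * (c%:P ^+ 2 * xi ^+ 3) * (pi - 1) ^+ 3 + 108); first by ring.
  by rewrite -e1 /s; ring.
pose r := 4 * om^`() * s - 3125 * c%:P ^+ 2 * om ^+ 5 * xi^`().
have div : 108 * xi^`() = om * r.
  transitivity (xi^`() * ((5 * pi - 2) * s) - 3125 * c%:P ^+ 2 * om ^+ 6 * xi^`()).
    by rewrite -bezout; ring.
  by rewrite mulrA -d2 /r; ring.
have szl : (size (om : {poly D}) <= size xi^`())%N.
  have nz : 108 * xi^`() != 0 by rewrite mulf_neq0 // natP_neq0.
  have -> : size xi^`() = size (108 * xi^`()).
    by rewrite -polyC_natr size_Cmul // natD_neq0.
  rewrite div in nz *; move: nz; rewrite mulf_eq0 negb_or => /andP[o0 r0].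
  rewrite size_mul //; move: r0; rewrite -size_poly_eq0.
  by case: (size r) => // n _; rewrite addnS leq_addr.
have lt := lt_size_deriv xi0.
have pi10 : pi - 1 != 0.
  apply: contraTneq xiS => /subr0_eq p1; move: e1; rewrite p1 expr1n.
  move=> /(congr1 (fun q : {poly D} => size q)).
  rewrite size_poly1 -polyC_exp size_Cmul ?expf_neq0 // => e.
  have := size_exp xi 3; rewrite -e /= => /esym/eqP; rewrite muln_eq0 orbF -leqNgt.
  by move/eqP; case: (size xi) => [|[]].
have om0 : om != 0.
  apply: contraNneq pi10 => o0; move/eqP: e2; rewrite o0 expr0n /= eq_sym.
  by rewrite mulf_eq0 (negPf xi0).
have sp : ((size pi).-1 * 2 = (size xi).-1 * 3)%N.
  by rewrite -!size_exp e1 -polyC_exp size_Cmul ?expf_neq0.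
have so : ((size om).-1 * 2 = (size xi).-1 + (size pi).-1)%N.
  rewrite -size_exp e2 size_mul // .
  have -> : size (pi - 1) = size pi.
    rewrite size_polyDl // size_polyN size_poly1.
    move: sp xiS; case: (size xi) => [|[|n]] //=; case: (size pi) => [|[|m]] //=; lia.
  move: xiS pi0; rewrite -size_poly_eq0; case: (size xi) => [|n] //.
  by case: (size pi) => [|m] //=; rewrite addnS.
move: sp so szl lt xiS om0 pi0; rewrite -!size_poly_eq0.
case: (size xi) => [|n] //=; case: (size pi) => [|m] //=; case: (size om) => [|l] //=.
lia.
Qed.
End PolynomialIdentities.

(** * Weights *)

Section Weights.
Variable k : fieldType.

(** The least exponent to which [y ^ 2 + 1] divides the coefficient of [x ^ j] in
an element of the coordinate ring: a pole of order three costs one factor. *)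
Definition wexp (j : int) : nat := if (0 <= j)%R then 0%N else ((`|j| + 2) %/ 3)%N.

(** The coefficient of [x ^ j] of smallest degree that the divisibility by
[y ^ 2 + 1] and the invariance under [(x, y) -> (- x, - y)] allow. *)
Definition wbase (j : int) : {poly k} := 'X ^+ odd `|j|%N * ('X^2 + 1) ^+ wexp j.

Definition weight (j : int) (f : {poly k}) : Prop :=
  exists g : {poly k}, f = wbase j * (g \Po ('X^2 + 1)).

Lemma odd_absz_add (i j : int) : odd `|(i + j)%R|%N = odd `|i|%N (+) odd `|j|%N.
Proof. lia. Qed.

Lemma wexp_add (i j : int) : (wexp (i + j) <= wexp i + wexp j)%N.
Proof. rewrite /wexp; case: ifP => //; case: ifP; case: ifP; lia. Qed.

Lemma wexp_sub6 (j : int) : (j <= 0)%R -> wexp (j - 6) = (wexp j + 2)%N.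
Proof. rewrite /wexp; case: ifP => //; case: ifP; lia. Qed.

Lemma weight0 j : weight j 0.
Proof. by exists 0; rewrite comp_poly0 mulr0. Qed.

Lemma weight_add j f g : weight j f -> weight j g -> weight j (f + g).
Proof. by move=> [a ->] [b ->]; exists (a + b); rewrite comp_polyD mulrDr. Qed.

Lemma weight_mul i j f g : weight i f -> weight j g -> weight (i + j) (f * g).
Proof.
move=> [a ->] [b ->].
pose e := (odd `|i| && odd `|j|)%N; pose d := (wexp i + wexp j - wexp (i + j))%N.
exists (a * b * ('X - 1) ^+ e * 'X ^+ d).
rewrite !comp_polyM !rmorphXn /= comp_polyB comp_polyX comp_polyC addrK.
have -> : wbase (i + j) * ((a \Po ('X^2 + 1)) * (b \Po ('X^2 + 1)) * 'X^2 ^+ e * ('X^2 + 1) ^+ d)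
  = (a \Po ('X^2 + 1)) * (b \Po ('X^2 + 1)) *
    ('X ^+ odd `|(i + j)%R|%N * 'X^2 ^+ e) * (('X^2 + 1) ^+ (wexp (i + j) + d)).
  by rewrite /wbase exprD; ring.
rewrite subnKC ?wexp_add // exprD odd_absz_add /e /wbase.
by case: (odd `|i|); case: (odd `|j|); rewrite /= ?expr0 ?expr1; ring.
Qed.
End Weights.

(** * Rigidity of locally nilpotent derivations *)

Section Grading.
Variables (k : closedFieldType) (char0 : [pchar k] =i pred0).
Variables (K : fieldType) (iota : {rmorphism {poly {poly k}} -> K}).
Hypothesis iota_inj : injective iota.

(** An abstract copy of [Rtilde k], known through its embedding in the function
field and its generators. *)
Variables (A : comAlgType k) (rho : {rmorphism A -> K}).
Hypothesis rho_inj : injective rho.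
Hypothesis rhoC : forall c, rho c%:A = fconst iota c.
Variables (mon : 'I_3 -> 'I_3 -> A) (T : A).
Hypothesis rho_mon : forall i j, rho (mon i j) = fcoord iota i * fcoord iota j.
Hypothesis rho_T : rho T = ft iota.
Hypothesis generated : forall S : {pred A}, subalg_closed S ->
  (forall i j, mon i j \in S) -> T \in S -> forall a, a \in S.

Local Notation fx := (fx iota).
Local Notation fy := (fy iota).

Definition fcoef : {rmorphism {poly k} -> K} := iota \o polyC.
Local Notation p := ('X^2 + 1 : {poly k}).

Lemma fcoefC c : fcoef c%:P = fconst iota c. Proof. by []. Qed.
Lemma fcoefX : fcoef 'X = fy. Proof. by []. Qed.
Lemma rhoZ c a : rho (c *: a) = fconst iota c * rho a.
Proof. by rewrite -[c *: a]mul1r -scalerAr scalerAl rmorphM rhoC. Qed.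

Lemma fcoef_p : fcoef p = fy ^+ 2 + 1.
Proof. by rewrite rmorphD rmorphXn rmorph1. Qed.

Lemma fconst_natV n : fconst iota n%:R^-1 = n%:R^-1.
Proof. by rewrite fmorphV rmorph_nat. Qed.

Let nat0 := fnat_neq0 char0 iota.
Let x0 := fx_neq0 iota_inj.
Let y0 := fy_neq0 iota_inj.

Definition wt (i : 'I_3) : int := if i == i0 then 1 else if i == i1 then 0 else -1.

Lemma mon_sym i j : mon i j = mon j i.
Proof. by apply: rho_inj; rewrite !rho_mon mulrC. Qed.

(** The torus acts on [x ^ 3 z = y ^ 2 + 1] with weights 1, 0 and -3 on [x], [y]
and [z]. *)
Definition homogeneous (j : int) (a : A) : Prop :=
  exists2 f, weight j f & rho a = fx ^ j * fcoef f.

Lemma homogeneous_intro j a g :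
  rho a = fx ^ j * (fcoef (wbase k j) * fcoef (g \Po p)) -> homogeneous j a.
Proof. by move=> e; exists (wbase k j * (g \Po p)); [exists g|rewrite rmorphM]. Qed.

Lemma homogeneous0 j : homogeneous j 0.
Proof. by exists 0; [exact: weight0|rewrite !rmorph0 mulr0]. Qed.

Lemma homogeneousD j a b : homogeneous j a -> homogeneous j b -> homogeneous j (a + b).
Proof.
move=> [f wf ea] [g wg eb]; exists (f + g); first exact: weight_add.
by rewrite !rmorphD mulrDr -ea -eb.
Qed.

Lemma homogeneousM i j a b :
  homogeneous i a -> homogeneous j b -> homogeneous (i + j) (a * b).
Proof.
move=> [f wf ea] [g wg eb]; exists (f * g); first exact: weight_mul.
by rewrite !rmorphM ea eb expfzDr //; ring.
Qed.

Lemma homogeneous_const c : homogeneous 0 c%:A.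
Proof.
apply: (@homogeneous_intro 0 _ c%:P); rewrite rhoC comp_polyC fcoefC expr0z mul1r.
by rewrite -[wbase k 0]/('X ^+ 0 * p ^+ 0) !expr0 mulr1 rmorph1 mul1r.
Qed.

Lemma homogeneous_mon i j : homogeneous (wt i + wt j) (mon i j).
Proof.
have n2 := nat0 1.
wlog le : i j / (i <= j)%N.
  move=> W; case/orP: (leq_total i j) => le; first exact: W.
  by rewrite mon_sym addrC; apply: W.
have h0 : (2^-1 : K) = fcoef (2^-1)%:P by rewrite fcoefC fconst_natV.
have wE j' e c : wbase k j' = 'X ^+ e * p ^+ c ->
    fcoef (wbase k j') = fy ^+ e * (fy ^+ 2 + 1) ^+ c.
  by move=> ->; rewrite rmorphM !(rmorphXn fcoef) fcoef_p.
move: i j le; elim/ord3P; elim/ord3P => //= _.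
- apply: (@homogeneous_intro 2 _ 1).
  by rewrite rho_mon (wE _ 0 0)%N // comp_polyC rmorph1 !mulr1.
- apply: (@homogeneous_intro 1 _ 1).
  by rewrite rho_mon (wE _ 1 0)%N // comp_polyC rmorph1 !mulr1.
- apply: (@homogeneous_intro 0 _ ((2^-1)%:P * 'X)).
  rewrite rho_mon (wE _ 0 0)%N // comp_polyM comp_polyX comp_polyC rmorphM fcoef_p -h0.
  by rewrite /fcoord /= expr0z; field; rewrite n2 x0.
- apply: (@homogeneous_intro 0 _ ('X - 1)).
  rewrite rho_mon (wE _ 0 0)%N // comp_polyB comp_polyX comp_polyC addrK (rmorphXn fcoef) fcoefX.
  by rewrite /fcoord /= expr0z; ring.
- apply: (@homogeneous_intro (-1) _ (2^-1)%:P).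
  rewrite rho_mon (wE _ 1 1)%N // comp_polyC -h0 /fcoord /= -[fx ^ -1]/(fx^-1).
  by field; rewrite n2 x0.
apply: (@homogeneous_intro (-2) _ ((2^-1)%:P * (2^-1)%:P * 'X)).
rewrite rho_mon (wE _ 0 1)%N // !comp_polyM comp_polyX !comp_polyC !rmorphM -h0 fcoef_p.
by rewrite /fcoord /= -[fx ^ -2]/((fx ^+ 2)^-1); field; rewrite n2 x0.
Qed.

Lemma homogeneous_T : homogeneous (-3) T.
Proof.
have n60 := nat0 59.
have h0 : (60^-1 : K) = fcoef (60^-1)%:P by rewrite fcoefC fconst_natV.
apply: (@homogeneous_intro (-3) _ ((60^-1)%:P * (3 * 'X + 4))).
rewrite comp_polyM comp_polyC comp_polyD comp_polyM comp_polyX.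
rewrite -!polyC_natr !comp_polyC !polyC_natr -[wbase k (-3)]/('X ^+ 1 * p ^+ 1) !expr1.
rewrite (rmorphM fcoef 'X) (rmorphM fcoef _%:P) (rmorphD fcoef (3 * p)) (rmorphM fcoef 3).
rewrite fcoef_p !(rmorph_nat fcoef) fcoefX -h0 rho_T /ft.
by rewrite -[fx ^ -3]/((fx ^+ 3)^-1); field; rewrite n60 x0.
Qed.

(** Homogeneous elements given by an expression in the generators, so that facts
about derivations and leading forms can be proved by induction on it. *)
Inductive graded : int -> A -> Prop :=
| graded0 j : graded j 0
| graded_const c : graded 0 c%:A
| graded_mon i j : graded (wt i + wt j) (mon i j)
| graded_T : graded (-3) T
| gradedD j a b : graded j a -> graded j b -> graded j (a + b)
| gradedM i j a b : graded i a -> graded j b -> graded (i + j) (a * b).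

Lemma graded_homogeneous j a : graded j a -> homogeneous j a.
Proof.
elim=> {j a} [j|c|i j||j a b _ ha _ hb|i j a b _ ha _ hb].
- exact: homogeneous0.
- exact: homogeneous_const.
- exact: homogeneous_mon.
- exact: homogeneous_T.
- exact: homogeneousD.
exact: homogeneousM.
Qed.

Lemma graded_sum j (I : Type) (r : seq I) (Q : pred I) (f : I -> A) :
  (forall i, Q i -> graded j (f i)) -> graded j (\sum_(i <- r | Q i) f i).
Proof. by move=> h; elim/big_ind: _ => //; [exact: graded0|exact: gradedD]. Qed.

(** A decomposition into homogeneous components is recorded as a polynomial with
these components as coefficients, so that products of decompositions are products
of polynomials. *)
Definition graded_poly (N : int) (s : {poly A}) := forall n : nat, graded (N + n%:Z) s`_n.

Lemma graded_polyM M N s t :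
  graded_poly M s -> graded_poly N t -> graded_poly (M + N) (s * t).
Proof.
move=> hs ht n; rewrite coefM; apply: graded_sum => i _.
have -> : M + N + n%:Z = (M + i%:Z) + (N + (n - i)%N%:Z).
  by have := ltn_ord i; move: (nat_of_ord i) => m; lia.
exact: gradedM.
Qed.

Lemma graded_poly_shift N (d : nat) s :
  graded_poly N s -> graded_poly (N - d%:Z) ('X^d * s).
Proof.
move=> hs n; rewrite coefXnM; case: ltnP => [_|le]; first exact: graded0.
by have -> : N - d%:Z + n%:Z = N + (n - d)%N%:Z by lia.
Qed.

Lemma graded_decomposition a :
  exists (N : int) (s : {poly A}), graded_poly N s /\ s.[1] = a.
Proof.
suff : a \in [pred a | `[< exists (N : int) (s : {poly A}), graded_poly N s /\ s.[1] = a >]].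
  by move/asboolP.
have one j b : graded j b -> graded_poly j b%:P.
  move=> hb n; rewrite coefC; case: n => [|n] /=; first by rewrite addr0.
  exact: graded0.
apply: generated => [|i j|].
- split.
  + apply/asboolP; exists 0, 1; split; last by rewrite hornerC.
    by apply: one; rewrite -(scale1r 1); apply: graded_const.
  + move=> c u v /asboolP[M [s [hs <-]]] /asboolP[N [t [ht <-]]]; apply/asboolP.
    have hs' := graded_polyM (one _ _ (graded_const c)) hs; rewrite add0r in hs'.
    have h1 := graded_poly_shift `|M|%N (graded_poly_shift `|N|%N hs').
    pose d := `|(N - (M - `|N|%:Z - `|M|%:Z))%R|%N.
    have h2 := graded_poly_shift d ht.
    exists (M - `|N|%:Z - `|M|%:Z), ('X^`|M| * ('X^`|N| * (c%:A%:P * s)) + 'X^d * t).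
    split=> [n|]; last by rewrite !(hornerD, hornerM, hornerXn, hornerC) !expr1n !mul1r mulr_algl.
    rewrite coefD; apply: gradedD; first exact: h1.
    have -> : M - `|N|%:Z - `|M|%:Z = N - d%:Z by rewrite /d; lia.
    exact: h2.
  move=> u v /asboolP[M [s [hs <-]]] /asboolP[N [t [ht <-]]]; apply/asboolP.
  by exists (M + N), (s * t); split; [exact: graded_polyM|rewrite hornerM].
- by apply/asboolP; exists (wt i + wt j), (mon i j)%:P; split;
    [apply: one; exact: graded_mon|rewrite hornerC].
by apply/asboolP; exists (-3), T%:P; split; [apply: one; exact: graded_T|rewrite hornerC].
Qed.

Lemma horner1 (s : {poly A}) : s.[1] = \sum_(i < size s) s`_i.
Proof. by rewrite horner_coef; apply: eq_bigr => i _; rewrite expr1n mulr1. Qed.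

Definition filt (j : int) (a : A) : Prop := exists q, rho a = fx ^ j * iota q.

Lemma filt0 j : filt j 0.
Proof. by exists 0; rewrite !rmorph0 mulr0. Qed.

Lemma filtD j a b : filt j a -> filt j b -> filt j (a + b).
Proof. by move=> [q eq] [r er]; exists (q + r); rewrite !rmorphD mulrDr -eq -er. Qed.

Lemma filtM i j a b : filt i a -> filt j b -> filt (i + j) (a * b).
Proof.
move=> [q eq] [r er]; exists (q * r).
by rewrite !rmorphM eq er expfzDr //; ring.
Qed.

Lemma filtZ j c a : filt j a -> filt j (c *: a).
Proof.
move=> [q eq]; exists (c%:P%:P * q).
by rewrite rhoZ eq rmorphM -[iota c%:P%:P]/(fconst iota c); ring.
Qed.

Lemma filt_le i j a : i <= j -> filt j a -> filt i a.
Proof.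
move=> le [q eq]; exists ('X ^+ `|(j - i)%R|%N * q).
rewrite eq rmorphM rmorphXn /= -/fx mulrA exprnP -expfzDr //.
by congr (fx ^ _ * _); lia.
Qed.

Lemma filt_sum j (I : Type) (r : seq I) (Q : pred I) (f : I -> A) :
  (forall i, Q i -> filt j (f i)) -> filt j (\sum_(i <- r | Q i) f i).
Proof. by move=> h; elim/big_ind: _ => //; [exact: filt0|exact: filtD]. Qed.

Lemma homogeneous_filt j a : homogeneous j a -> filt j a.
Proof. by move=> [f _ ea]; exists f%:P. Qed.

Lemma graded_poly_filt j s : graded_poly j s -> filt j s.[1].
Proof.
move=> hs; rewrite horner1; apply: filt_sum => i _.
apply: (@filt_le _ (j + i%:Z)); first by lia.
exact/homogeneous_filt/graded_homogeneous/hs.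
Qed.

Lemma filt_bounded a : exists N : nat, filt (- N%:Z) a.
Proof.
have [N [s [hs <-]]] := graded_decomposition a; exists `|N|%N.
by apply: filt_le (graded_poly_filt hs); lia.
Qed.

(** The components of degree less than [j] cancel in the function field, hence
vanish. *)
Lemma filt_decomposition j a :
  filt j a -> exists s : {poly A}, graded_poly j s /\ s.[1] = a.
Proof.
move=> [q eq]; have [N [s0 [hs0 es0]]] := graded_decomposition a.
have [M [s [hs es Mj]]] : exists M : int, exists s : {poly A},
    [/\ graded_poly M s, s.[1] = a & M <= j].
  exists (N - `|(N - j)%R|%:Z), ('X ^+ `|(N - j)%R|%N * s0); split; last by lia.
    exact: graded_poly_shift.
  by rewrite hornerM hornerXn expr1n mul1r.
have hom n : exists f, rho s`_n = fx ^ (M + n%:Z) * fcoef f.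
  by have [f _ ef] := graded_homogeneous (hs n); exists f.
have [f ef] := boolp.choice hom.
pose e := `|(j - M)%R|%N; have je : j = M + e%:Z by rewrite /e; lia.
have Q : \poly_(n < size s) f n = 'X^e * q.
  apply: iota_inj; apply: (mulfI (expfz_neq0 M x0)).
  rewrite rmorphM rmorphXn /= -/fx mulrA -[fx ^+ e]/(fx ^ e%:Z) -expfzDr // -je -eq.
  rewrite -es horner1 poly_def !rmorph_sum mulr_sumr; apply: eq_bigr => n _.
  rewrite ef -mul_polyC rmorphM rmorphXn /= -/fx expfzDr // -[fx ^+ n]/(fx ^ n%:Z).
  by rewrite -[iota (f n)%:P]/(fcoef (f n)); ring.
have low n : (n < e)%N -> s`_n = 0.
  move=> lt; have [le|lts] := leqP (size s) n; first by rewrite nth_default.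
  apply: rho_inj; rewrite ef.
  have /(congr1 (fun r : {poly {poly k}} => r`_n)) := Q.
  by rewrite coef_poly lts coefXnM lt => ->; rewrite !rmorph0 mulr0.
exists (drop_poly e s); split=> [n|].
  rewrite coef_drop_poly je -addrA; have -> : e%:Z + n%:Z = (n + e)%N%:Z by lia.
  exact: hs.
rewrite -es -[in RHS](poly_take_drop e s) hornerD hornerM hornerXn expr1n mulr1.
suff -> : take_poly e s = 0 by rewrite horner0 add0r.
apply/polyP => n; rewrite coef_take_poly coef0; case: ltnP => // lt.
exact: low.
Qed.

Lemma filt_lead_weight j a (q : {poly {poly k}}) :
  rho a = fx ^ j * iota q -> exists2 b, graded j b & rho b = fx ^ j * fcoef q`_0 /\ weight j q`_0.
Proof.
move=> eq; have [|s [hs es]] := @filt_decomposition j a; first by exists q.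
have h0 : graded j s`_0 by have := hs 0%N; rewrite addr0.
exists s`_0 => //; have [f wf ef] := graded_homogeneous h0.
have [r er] : filt (j + 1) (a - s`_0).
  have -> : a - s`_0 = (drop_poly 1 s).[1].
    rewrite -es -{1}(poly_take_drop 1 s) hornerD hornerM hornerXn expr1n mulr1.
    have -> : (take_poly 1 s).[1] = s`_0; last by rewrite addrAC subrr add0r.
    suff -> : take_poly 1 s = (s`_0)%:P by rewrite hornerC.
    by apply/polyP => -[|n]; rewrite coef_take_poly coefC.
  apply: graded_poly_filt => n; rewrite coef_drop_poly.
  by have -> : j + 1 + n%:Z = j + (n + 1)%N%:Z by lia; exact: hs.
suff <- : f = q`_0 by split.
have : q - f%:P = 'X * r.
  apply: iota_inj; apply: (mulfI (expfz_neq0 j x0)).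
  rewrite rmorphB mulrBr -eq -[iota f%:P]/(fcoef f) -ef -rmorphB er rmorphM -/fx.
  by rewrite mulrA expfzDr // expr1z.
move/(congr1 (fun r : {poly {poly k}} => r`_0)).
by rewrite coefB coefC coefXM /= => /subr0_eq.
Qed.

Definition pA : A := mon i1 i1 + 1.

Lemma rho_pA : rho pA = fy ^+ 2 + 1.
Proof. by rewrite rmorphD rmorph1 rho_mon /fcoord /= expr2. Qed.

Definition pA_eval : {rmorphism {poly k} -> A} := horner_alg pA.

Lemma rho_pA_eval g : rho (pA_eval g) = fcoef (g \Po p).
Proof.
have evC c : pA_eval c%:P = c%:A by exact: horner_algC.
have evX : pA_eval 'X = pA by exact: horner_algX.
elim/poly_ind: g => [|g c IH]; first by rewrite comp_poly0 !rmorph0.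
rewrite comp_polyD comp_polyM comp_polyX comp_polyC (rmorphD pA_eval) (rmorphM pA_eval).
rewrite evX evC (rmorphD rho) (rmorphM rho) IH rho_pA rhoC.
by rewrite (rmorphD fcoef) (rmorphM fcoef) fcoef_p.
Qed.

(** Writing [z = (y ^ 2 + 1) / x ^ 3], these are [x * z], [y * z] and [z ^ 2].  The
formulas come from [60 T = y z (3 y ^ 2 + 7)]: as [y ^ 2 = x ^ 3 z - 1] and
[2 x2 = x ^ 2 z], it yields [z = - 15 y T + x ^ 3 z ^ 2 / 4 + 6 x2 ^ 3], which is
then multiplied by [x], [y] and [z]. *)
Lemma deep_elements : exists U V Z, [/\ rho U = (fy ^+ 2 + 1) / fx ^+ 2,
  rho V = fy * (fy ^+ 2 + 1) / fx ^+ 3 & rho Z = (fy ^+ 2 + 1) ^+ 2 / fx ^+ 6].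
Proof.
have n2 := nat0 1; have n4 := nat0 3; have n60 := nat0 59.
pose U := - 15 * mon i0 i1 * T + mon i2 i2 + 6 * mon i0 i2 * mon i2 i2.
have eU : rho U = (fy ^+ 2 + 1) / fx ^+ 2.
  rewrite !rmorphD !rmorphM rmorphN !rmorph_nat !rho_mon rho_T /ft /fcoord /=.
  by field; rewrite n2 n60 x0.
pose V := - 15 * mon i1 i1 * T + 2^-1 *: (mon i1 i2 * U) + 6 * mon i1 i2 * mon i2 i2.
have eV : rho V = fy * (fy ^+ 2 + 1) / fx ^+ 3.
  rewrite !rmorphD rhoZ fconst_natV !rmorphM rmorphN !rmorph_nat eU.
  rewrite !rho_mon rho_T /ft /fcoord /=.
  by field; rewrite n2 n60 x0.
exists U, V, (- 15 * V * T + 4^-1 *: (U * U * U) + 3 * (U * U) * mon i2 i2); split=> //.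
rewrite !rmorphD rhoZ fconst_natV !rmorphM rmorphN !rmorph_nat eU eV.
rewrite !rho_mon rho_T /ft /fcoord /=.
by field; rewrite n2 n4 n60 x0.
Qed.

Lemma homogeneous_generator j : exists a, rho a = fx ^ j * fcoef (wbase k j).
Proof.
have [U [V [Z [eU eV eZ]]]] := deep_elements.
have wE j' : fcoef (wbase k j') = fy ^+ odd `|j'| * (fy ^+ 2 + 1) ^+ wexp j'.
  by rewrite rmorphM !(rmorphXn fcoef) fcoef_p.
case: j => n.
  exists (mon i0 i0 ^+ n./2 * mon i0 i1 ^+ odd n).
  rewrite wE /wexp /= expr0 mulr1 rmorphM !rmorphXn /= !rho_mon /fcoord /=.
  rewrite -exprnP -[X in fx ^+ X]odd_double_half exprD -mul2n exprM expr2 !exprMn.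
  by ring.
elim/ltn_ind: n => n IH.
have [le|gt] := leqP 6 n.
  have [a ea] := IH (n - 6)%N ltac:(lia).
  exists (Z * a); rewrite rmorphM eZ ea !wE.
  have -> : Negz n = Negz (n - 6) - 6 by lia.
  rewrite wexp_sub6 // exprD expfzDr // -[fx ^ -6]/((fx ^+ 6)^-1).
  have -> : odd `|(Negz (n - 6) - 6)%R| = odd `|Negz (n - 6)| by lia.
  by field.
case: n gt {IH} => [|[|[|[|[|[|//]]]]]] _.
- exists (mon i0 i0 * V); rewrite wE rmorphM rho_mon /fcoord /= eV.
  by rewrite -[fx ^ Negz 0]/(fx^-1) /wexp /=; field.
- exists U; rewrite eU wE.
  by rewrite -[fx ^ Negz 1]/((fx ^+ 2)^-1) /wexp /=; field.
- exists V; rewrite eV wE.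
  by rewrite -[fx ^ Negz 2]/((fx ^+ 3)^-1) /wexp /=; field.
- exists (mon i0 i0 * Z); rewrite wE rmorphM rho_mon /fcoord /= eZ.
  by rewrite -[fx ^ Negz 3]/((fx ^+ 4)^-1) /wexp /=; field.
- exists (mon i0 i1 * Z); rewrite wE rmorphM rho_mon /fcoord /= eZ.
  by rewrite -[fx ^ Negz 4]/((fx ^+ 5)^-1) /wexp /=; field.
exists Z; rewrite eZ wE.
by rewrite -[fx ^ Negz 5]/((fx ^+ 6)^-1) /wexp /=; field.
Qed.

Lemma weight_realized j f : weight j f -> exists a, rho a = fx ^ j * fcoef f.
Proof.
move=> [g ->]; have [a ea] := homogeneous_generator j.
exists (a * pA_eval g).
by rewrite (rmorphM rho) ea rho_pA_eval (rmorphM fcoef (wbase k j)) mulrA.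
Qed.

Section LeadingForms.
Variables (D : A -> A) (derD : derivation D) (nilD : locally_nilpotent D).

Definition lowers (m : nat) : Prop := forall j a, filt j a -> filt (j - m%:Z) (D a).

(** Each of the finitely many generators is lowered by a bounded amount. *)
Lemma lowers_exists : exists m, lowers m.
Proof.
have [N hN] := boolp.choice (fun u : 'I_3 * 'I_3 => filt_bounded (D (mon u.1 u.2))).
have [NT hNT] := filt_bounded (D T).
pose M := (\sum_u N u + NT + 2)%N; exists M.
have NM u : (N u + 2 <= M)%N.
  have : (N u <= \sum_u N u)%N by rewrite (bigD1 u) //= leq_addr.
  by rewrite /M; lia.
have wt1 i : wt i <= 1 by rewrite /wt; case: ifP => _; [|case: ifP].
have gD j a : graded j a -> filt (j - M%:Z) (D a).
  elim=> {j a} [j|c|i j||j a b _ ha _ hb|i j a b ga ha gb hb].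
  - by rewrite (derivation0 derD); exact: filt0.
  - by rewrite (derivation_const derD); exact: filt0.
  - apply: filt_le (hN (i, j)); have := NM (i, j); have := wt1 i; have := wt1 j.
    by move: (wt i) (wt j) (N _); lia.
  - by apply: filt_le hNT; rewrite /M; lia.
  - by rewrite (derivationD derD); exact: filtD.
  rewrite (derivationM derD); apply: filtD.
    have -> : i + j - M%:Z = (i - M%:Z) + j by lia.
    exact: filtM ha (homogeneous_filt (graded_homogeneous gb)).
  have -> : i + j - M%:Z = i + (j - M%:Z) by lia.
  exact: filtM (homogeneous_filt (graded_homogeneous ga)) hb.
move=> j a /filt_decomposition[s [hs <-]].
rewrite horner1 (derivation_sum derD); apply: filt_sum => i _.
by apply: filt_le (gD _ _ (hs i)); lia.
Qed.

Local Notation Phi := (exp_map derD char0 nilD).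
Local Notation ev0 := (horner_eval (0 : {poly k})).

Section Weighted.
Variable m : nat.

(** The parameter of the exponential gets degree [m], so that the exponential
respects the filtration when [D] lowers degrees by at most [m]. *)
Definition weighted_exp : {rmorphism A -> {poly K}} :=
  comp_poly (fx ^+ m *: 'X) \o (map_poly rho \o Phi).

Lemma coef_weighted_exp a n :
  (weighted_exp a)`_n = rho (divided_iter D n a) * fx ^+ (m * n).
Proof.
rewrite -[weighted_exp a]/(map_poly rho (Phi a) \Po (fx ^+ m *: 'X)) comp_polyE.
under eq_bigr do rewrite exprZn scalerA -exprM.
rewrite -(poly_def _ (fun i => (map_poly rho (Phi a))`_i * fx ^+ (m * i))) coef_poly.
rewrite coef_map /= coef_exp_map; case: ltnP => // le.
have := nth_default 0 le; rewrite coef_map /= coef_exp_map => ->.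
by rewrite mul0r.
Qed.

Lemma weighted_exp_deriv a : (weighted_exp a)^`() = (fx ^+ m)%:P * weighted_exp (D a).
Proof.
apply/polyP => n; rewrite coef_deriv coefCM !coef_weighted_exp mulnS exprD.
have -> : rho (divided_iter D n (D a)) = n.+1%:R * rho (divided_iter D n.+1 a).
  rewrite mulr_natl -rmorphMn -scaler_nat (divided_iterS derD char0).
  by rewrite /divided_iter (derivationZ derD) -iterS -iterSr.
by rewrite -mulr_natl; ring.
Qed.

(** [Q] is the exponential of the component of degree [j] of [a] under the
component of degree [- m] of [D]. *)
Definition lead (j : int) (a : A) (Q : {poly {poly k}}) : Prop :=
  exists q : {poly {poly {poly k}}},
    weighted_exp a = (fx ^ j)%:P * map_poly iota q /\ map_poly ev0 q = Q.

Lemma lead_const c : lead 0 c%:A c%:P%:P.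
Proof.
exists c%:P%:P%:P; rewrite !map_polyC /=; split; last by rewrite /horner_eval hornerC.
rewrite expr0z mul1r; apply/polyP => n; rewrite coef_weighted_exp coefC.
case: n => [|n] /=.
  by rewrite muln0 expr0 mulr1 /divided_iter fact0 invr1 scale1r rhoC.
rewrite /divided_iter iterSr (derivation_const derD) (iter_derivation0 derD).
by rewrite scaler0 rmorph0 mul0r.
Qed.

Lemma leadD j a b P Q : lead j a P -> lead j b Q -> lead j (a + b) (P + Q).
Proof.
move=> [q [eq <-]] [r [er <-]]; exists (q + r).
by rewrite !rmorphD mulrDr -eq -er.
Qed.

Lemma leadM i j a b P Q : lead i a P -> lead j b Q -> lead (i + j) (a * b) (P * Q).
Proof.
move=> [q [eq <-]] [r [er <-]]; exists (q * r).
by rewrite !rmorphM eq er expfzDr // polyCM; split=> //; ring.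
Qed.

Lemma leadN j a P : lead j a P -> lead j (- a) (- P).
Proof.
by move=> [q [eq <-]]; exists (- q); rewrite !rmorphN mulrN -eq.
Qed.

Lemma leadB j a b P Q : lead j a P -> lead j b Q -> lead j (a - b) (P - Q).
Proof. by move=> ha hb; apply: leadD => //; apply: leadN. Qed.

Lemma lead_inj j a P Q : lead j a P -> lead j a Q -> P = Q.
Proof.
move=> [q [eq <-]] [r [er <-]]; congr (map_poly _ _).
apply/polyP => n; apply: iota_inj; apply: (mulfI (expfz_neq0 j x0)).
by rewrite -!coef_map -!coefCM -eq -er.
Qed.

Lemma lead_derivation j a P : lead j a P -> lead (j - m%:Z) (D a) P^`().
Proof.
move=> [q [eq <-]]; exists q^`(); rewrite deriv_map; split=> //.
have xm : (fx ^+ m)%:P != 0 :> {poly K} by rewrite polyC_eq0 expf_neq0.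
apply: (mulfI xm); rewrite -weighted_exp_deriv eq derivM derivC mul0r add0r deriv_map.
by rewrite mulrA -polyCM -[fx ^+ m]/(fx ^ m%:Z) -expfzDr // addrC subrK.
Qed.

Lemma lead_coef0 j a P : lead j a P ->
  exists2 q, rho a = fx ^ j * iota q & q`_0 = P`_0.
Proof.
move=> [q [eq <-]]; exists q`_0; last by rewrite coef_map /= /horner_eval horner_coef0.
have /(congr1 (fun r : {poly K} => r`_0)) := eq.
rewrite coef_weighted_exp muln0 expr0 mulr1 coefCM coef_map /= => <-.
by rewrite /divided_iter fact0 invr1 scale1r.
Qed.

Section Lowering.
Hypothesis lowD : lowers m.

Lemma filt_divided_iter j n a : filt j a -> filt (j - (m * n)%N%:Z) (divided_iter D n a).
Proof.
move=> fa; apply: filtZ; elim: n => [|n IH]; first by rewrite muln0 subr0.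
have -> : j - (m * n.+1)%N%:Z = (j - (m * n)%N%:Z) - m%:Z by rewrite mulnS; lia.
exact: lowD.
Qed.

Lemma lead_exists j a : filt j a -> exists P, lead j a P.
Proof.
move=> fa.
have [q eq] := boolp.choice (fun n => filt_divided_iter n fa).
exists (map_poly ev0 (\poly_(n < size (weighted_exp a)) q n)).
eexists; split; last by [].
apply/polyP => n; rewrite coefCM coef_map coef_poly /=.
case: ltnP => [_|le]; last by rewrite (nth_default _ le) /= rmorph0 mulr0.
rewrite coef_weighted_exp eq mulrAC -[fx ^+ _]/(fx ^ (m * n)%N%:Z) -expfzDr //.
by rewrite subrK.
Qed.

Lemma lead_filt j a P : lead j a P -> P`_0 = 0 -> filt (j + 1) a.
Proof.
move=> /lead_coef0[q eq <-] q0; exists (drop_poly 1 q).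
rewrite eq -[in LHS](poly_take_drop 1 q).
have -> : take_poly 1 q = 0.
  by apply/polyP => -[|n]; rewrite coef_take_poly coef0.
by rewrite add0r rmorphM expr1 -/fx expfzDr // expr1z; ring.
Qed.

Lemma lead_eq0 j a P : lead j a P -> P`_0 = 0 -> P = 0.
Proof.
move=> lP P0; have [Q [q [eq _]]] := lead_exists (lead_filt lP P0).
apply: lead_inj lP _; exists ('X%:P * q); split.
  by rewrite eq rmorphM /= map_polyC /= -/fx expfzDr // expr1z polyCM mulrA.
by rewrite rmorphM /= map_polyC /= /horner_eval hornerX polyC0 mul0r.
Qed.

Lemma lead_unique j a b P Q : lead j a P -> lead j b Q -> P`_0 = Q`_0 -> P = Q.
Proof.
move=> ha hb e; apply/subr0_eq; apply: (lead_eq0 (leadB ha hb)).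
by rewrite coefB e subrr.
Qed.

Lemma lead_coef_exists j a f : rho a = fx ^ j * fcoef f ->
  exists2 P, lead j a P & P`_0 = f.
Proof.
move=> ea; have [|P lP] := @lead_exists j a; first by exists f%:P.
exists P => //; have [q eq <-] := lead_coef0 lP.
have : iota q = iota f%:P by apply: (mulfI (expfz_neq0 j x0)); rewrite -eq ea.
by move/iota_inj => ->; rewrite coefC.
Qed.
End Lowering.
End Weighted.

Lemma pchar_polyk : [pchar {poly k}] =i pred0.
Proof.
by move=> n; rewrite pchar_poly char0.
Qed.

Lemma weight_sub6 j f : j <= 0 -> weight (j - 6) f ->
  exists2 g, weight j g & f = p ^+ 2 * g.
Proof.
move=> j0 [g ->]; exists (wbase k j * (g \Po p)); first by exists g.
rewrite mulrA; congr (_ * _); rewrite /wbase wexp_sub6 // exprD.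
have -> : odd `|(j - 6)%R| = odd `|j| by lia.
by ring.
Qed.

(** Let [d] be the part of [D] of degree [- m.+1]; it is to be shown that [d]
vanishes.  As [d] lowers degrees, [d (z ^ 2)] lies in a degree all of whose elements
are multiples of [z ^ 2], hence it is zero by local nilpotency.  Along the
exponential of [d] the relation [x ^ 3 z = y ^ 2 + 1] thus becomes a polynomial
parametrization of the curve [z x ^ 3 = y ^ 2 + 1] with [z] constant.  There is none
but the constant ones, so [x ^ 2], [x y] and [y ^ 2] are killed too, and with them
every generator. *)
Lemma lowers_pred m : lowers m.+1 -> lowers m.
Proof.
move=> low; have pk := pchar_polyk.
have p0 : p != 0 by rewrite -size_poly_eq0 size_polyDl ?size_polyXn ?size_poly1.
have [_ [_ [Z [_ _ eZ]]]] := deep_elements.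
have [zeta lZ zeta0] : exists2 P, lead m.+1 (-6) Z P & P`_0 = p ^+ 2.
  apply: (lead_coef_exists low); rewrite eZ (rmorphXn fcoef) fcoef_p.
  by rewrite -[fx ^ -6]/((fx ^+ 6)^-1) mulrC.
have dzeta : zeta^`() = 0.
  have dZ := lead_derivation lZ.
  have [q eq q0] := lead_coef0 dZ.
  have [_ _ [_ wq]] := filt_lead_weight eq.
  have e6 : -6 - m.+1%:Z = - m.+1%:Z - 6 by lia.
  rewrite e6 in wq; have [|g wg eg] := weight_sub6 _ wq; first by lia.
  have [b eb] := weight_realized wg.
  have [beta lb beta0] := lead_coef_exists low eb.
  apply: (@deriv_multiple_eq0 _ _ beta).
  apply: (lead_unique low dZ (leadM lZ lb)).
  by rewrite -q0 eg coefM big_ord_recl big_ord0 addr0 subnn zeta0 beta0.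
have zetaE : zeta = (p ^+ 2)%:P by rewrite (deriv_eq0_const pk dzeta) zeta0.
have [xi lX xi0] : exists2 P, lead m.+1 2 (mon i0 i0) P & P`_0 = 1.
  by apply: (lead_coef_exists low); rewrite rmorph1 mulr1 rho_mon.
have [pi lp pi0] : exists2 P, lead m.+1 0 pA P & P`_0 = p.
  by apply: (lead_coef_exists low); rewrite rho_pA fcoef_p expr0z mul1r.
have [om lW om0] : exists2 P, lead m.+1 1 (mon i0 i1) P & P`_0 = 'X.
  by apply: (lead_coef_exists low); rewrite rho_mon.
have l1 : lead m.+1 0 1 1 by rewrite -(scale1r 1); exact: lead_const.
have e1 : pi ^+ 2 = p%:P ^+ 2 * xi ^+ 3.
  have eA : pA * pA = Z * (mon i0 i0 * (mon i0 i0 * mon i0 i0)).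
    by apply: rho_inj; rewrite !rmorphM rho_pA eZ rho_mon /fcoord /=; field.
  have := lead_inj (leadM lp lp).
  rewrite eA => /(_ _ (leadM lZ (leadM lX (leadM lX lX)))).
  by move=> h; rewrite [LHS]expr2 h zetaE polyC_exp; ring.
have e2 : om ^+ 2 = xi * (pi - 1).
  have eA : mon i0 i1 * mon i0 i1 = mon i0 i0 * (pA - 1).
    by apply: rho_inj; rewrite !rmorphM rmorphB rmorph1 rho_pA !rho_mon /fcoord /=; ring.
  have := lead_inj (leadM lW lW).
  by rewrite eA => /(_ _ (leadM lX (leadB lp l1))) h; rewrite [LHS]expr2.
have xin0 : xi != 0 by apply: contra_eq_neq xi0 => ->; rewrite coef0 eq_sym oner_eq0.
have dxi := cusp_rigidity pk p0 xin0 e1 e2.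
have xi1 : xi = 1 by rewrite (deriv_eq0_const pk dxi) xi0.
rewrite xi1 in lX e1 e2.
have half (P Q : {poly {poly k}}) : P`_0 != 0 -> P ^+ 2 = Q -> Q^`() = 0 -> P^`() = 0.
  move=> P0 <- /eqP; rewrite expr2 derivM.
  have -> : P^`() * P + P * P^`() = 2 * P * P^`() by ring.
  rewrite !mulf_eq0 (negPf (natP_neq0 pk 1)) /= => /orP[/eqP PP|/eqP//].
  by rewrite PP coef0 eqxx in P0.
have dpi : pi^`() = 0.
  by apply: half e1 _; rewrite ?pi0 // expr1n mulr1 -polyC_exp derivC.
have dom : om^`() = 0.
  apply: half e2 _; first by rewrite om0 polyX_eq0.
  by rewrite mul1r derivB dpi derivC subr0.
pose stationary j a := exists2 P, lead m.+1 j a P & P^`() = 0.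
have stationaryM i j a b : stationary i a -> stationary j b -> stationary (i + j) (a * b).
  move=> [P lP dP] [Q lQ dQ]; exists (P * Q); first exact: leadM.
  by rewrite derivM dP dQ mul0r mulr0 addr0.
have stationaryD j a b : stationary j a -> stationary j b -> stationary j (a + b).
  move=> [P lP dP] [Q lQ dQ]; exists (P + Q); first exact: leadD.
  by rewrite derivD dP dQ addr0.
have stationary_const c : stationary 0 c%:A.
  by exists c%:P%:P; [exact: lead_const|rewrite derivC].
have stationary_nat n j a : stationary j a -> stationary j (n%:R * a).
  by move=> h; rewrite -[j]add0r -scaler_nat; apply: stationaryM.
have cancel n j a : graded j a -> stationary (2 + j) (n.+1%:R * (mon i0 i0 * a)) ->
    stationary j a.
  move=> ga [Q lQ dQ].
  have [P lP] := lead_exists low (homogeneous_filt (graded_homogeneous ga)).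
  exists P => //; have ln : lead m.+1 0 n.+1%:R n.+1%:R.
    by rewrite -scaler_nat -[X in lead _ _ _ X]polyC_natr -polyC_natr; exact: lead_const.
  have := leadM ln (leadM lX lP); rewrite add0r => /(lead_inj lQ) QE.
  move: dQ; rewrite QE mul1r -[n.+1%:R]polyC_natr derivM derivC mul0r add0r => /eqP.
  by rewrite mulf_eq0 polyC_eq0 (negPf (natD_neq0 pk n)) => /eqP.
have sX : stationary 2 (mon i0 i0) by exists 1 => //; rewrite derivC.
have sW : stationary 1 (mon i0 i1) by exists om.
have sp : stationary 0 pA by exists pi.
have s02 : stationary 0 (mon i0 i2).
  apply: (cancel 1%N); first exact: (graded_mon i0 i2).
  have -> : 2 * (mon i0 i0 * mon i0 i2) = mon i0 i0 * pA.
    apply: rho_inj; rewrite !rmorphM rmorph_nat rho_pA !rho_mon /fcoord /=.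
    by have n2 := nat0 1; field; rewrite n2 x0.
  exact: stationaryM.
have s12 : stationary (-1) (mon i1 i2).
  apply: (cancel 0%N); first exact: (graded_mon i1 i2).
  have -> : 1 * (mon i0 i0 * mon i1 i2) = mon i0 i1 * mon i0 i2.
    by apply: rho_inj; rewrite mul1r !rmorphM !rho_mon /fcoord /=; ring.
  exact: (stationaryM _ _ _ _ sW s02).
have s22 : stationary (-2) (mon i2 i2).
  apply: (cancel 0%N); first exact: (graded_mon i2 i2).
  have -> : 1 * (mon i0 i0 * mon i2 i2) = mon i0 i2 * mon i0 i2.
    by apply: rho_inj; rewrite mul1r !rmorphM !rho_mon /fcoord /=; ring.
  exact: (stationaryM _ _ _ _ s02 s02).
have s11 : stationary 0 (mon i1 i1).
  have -> : mon i1 i1 = pA + (-1)%:A by rewrite /pA scaleN1r addrK.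
  exact: stationaryD.
have sT : stationary (-3) T.
  apply: (cancel 14%N); first exact: graded_T.
  have -> : 15 * (mon i0 i0 * T) = 3 * (mon i0 i1 * mon i2 i2) + 2 * mon i1 i2.
    apply: rho_inj; rewrite !(rmorphD, rmorphM, rmorph_nat) rho_T !rho_mon /ft /fcoord /=.
    by have n2 := nat0 1; have n60 := nat0 59; field; rewrite n2 n60 x0.
  apply: stationaryD; apply: stationary_nat => //.
  exact: (stationaryM _ _ _ _ sW s22).
have smon i j : stationary (wt i + wt j) (mon i j).
  wlog le : i j / (i <= j)%N.
    move=> H; case/orP: (leq_total i j) => le; first exact: H.
    by rewrite mon_sym addrC; apply: H.
  by move: i j le; elim/ord3P; elim/ord3P.
have sgraded j a : graded j a -> stationary j a.
  elim=> {j a} [j|c|i j||j a b _ ha _ hb|i j a b _ ha _ hb] //.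
  - exists 0; last by rewrite deriv0.
    by exists 0; rewrite !rmorph0 mulr0.
  - exact: stationaryD.
  exact: stationaryM.
move=> j a fa; have [P lP] := lead_exists low fa.
have [q eq q0] := lead_coef0 lP; have [b gb [eb _]] := filt_lead_weight eq.
have [Q lQ dQ] := sgraded _ _ gb.
have PQ : P = Q.
  apply: (lead_unique low lP lQ); rewrite -q0.
  have [r er <-] := lead_coef0 lQ.
  have : iota r = iota (q`_0)%:P by apply: (mulfI (expfz_neq0 j x0)); rewrite -er eb.
  by move/iota_inj => ->; rewrite coefC.
have := lead_filt (lead_derivation lP); rewrite PQ dQ coef0 => /(_ erefl).
by have -> : j - m.+1%:Z + 1 = j - m%:Z by lia.
Qed.

(** Once [D] lowers no degree, it sends [x ^ 2] to a multiple of [x ^ 2], which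
local nilpotency forbids unless it is zero. *)
Lemma locally_nilpotent_kills_mon00 : D (mon i0 i0) = 0.
Proof.
have low : lowers 0.
  by have [m] := lowers_exists; elim: m => // m IH /lowers_pred.
have [|s [hs es]] := @filt_decomposition 2 (D (mon i0 i0)).
  rewrite -(subr0 2); apply: low; exists 1.
  by rewrite rmorph1 mulr1 rho_mon.
have [b eb] : exists b, D (mon i0 i0) = mon i0 i0 * b.
  rewrite -es horner1; elim/big_ind: _ => [|_ _ [b ->] [c ->]|n _].
  - by exists 0; rewrite mulr0.
  - by exists (b + c); rewrite mulrDr.
  have [f [g ef] efs] := graded_homogeneous (hs n).
  have [|b eb] := @weight_realized n%:Z f.
    exists g; rewrite ef; congr (_ * _); rewrite /wbase.
    by rewrite odd_absz_add -[odd `|2|%N]/false addFb.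
  by exists b; apply: rho_inj; rewrite rmorphM efs eb rho_mon /fcoord /= expfzDr // mulrA.
pose E (a : A) : {poly K} := map_poly rho (exp_map derD char0 nilD a).
have dE : (E (mon i0 i0))^`() = 0.
  apply: (@deriv_multiple_eq0 _ _ (E b)).
  by rewrite /E deriv_map -(exp_map_deriv derD char0 nilD) eb !rmorphM.
apply: rho_inj; rewrite rmorph0 -[D _](exp_map_coef0 derD char0 nilD).
by rewrite exp_map_deriv -coef_map -deriv_map -/(E _) dE coef0.
Qed.
End LeadingForms.

Lemma mulA_eq0 (a b : A) : a * b = 0 -> a != 0 -> b = 0.
Proof.
move=> ab a0; have ra : rho a != 0.
  by apply: contra_neq a0 => e; apply: rho_inj; rewrite e rmorph0.
by apply: rho_inj; apply: (mulfI ra); rewrite -rmorphM ab !rmorph0 mulr0.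
Qed.

(** The fraction field of [A] is algebraic over the field generated by
[mon i0 i0] and [mon i1 i1]. *)
Lemma derivation_eq0 (E : A -> A) : derivation E ->
  E (mon i0 i0) = 0 -> E (mon i1 i1) = 0 -> forall a, E a = 0.
Proof.
move=> derE E00 E11.
have X0 : mon i0 i0 != 0.
  by rewrite -(inj_eq rho_inj) rmorph0 rho_mon mulf_neq0.
have W0 : mon i0 i1 != 0.
  by rewrite -(inj_eq rho_inj) rmorph0 rho_mon mulf_neq0.
have cancel n a b : E b = 0 -> n.+1%:R * (mon i0 i0 * a) = b -> E a = 0.
  move=> Eb e; have : n.+1%:R *: (mon i0 i0 * E a) = 0.
    by rewrite scaler_nat -mulr_natl -[RHS]Eb -e (derivation_natM derE) (derivationM derE)
      E00 mul0r add0r.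
  move/eqP; rewrite scaler_eq0; have /pcharf0P -> := char0 => /= /eqP.
  by move/mulA_eq0; apply.
have E01 : E (mon i0 i1) = 0.
  have e : mon i0 i1 * mon i0 i1 = mon i0 i0 * mon i1 i1.
    by apply: rho_inj; rewrite !rmorphM !rho_mon; ring.
  have /(congr1 E) := e; rewrite !(derivationM derE) E00 E11 mul0r mulr0 addr0 => h.
  have : 2%:R *: (mon i0 i1 * E (mon i0 i1)) = 0.
    by rewrite scaler_nat mulr2n -[RHS]h [E _ * _]mulrC.
  move/eqP; rewrite scaler_eq0; have /pcharf0P -> := char0 => /= /eqP.
  by move/mulA_eq0; apply.
have E02 : E (mon i0 i2) = 0.
  apply: (cancel 1%N _ (mon i0 i0 * (mon i1 i1 + 1))).
    by rewrite (derivationM derE) (derivationD derE) (derivation1 derE) E00 E11 mul0r addr0 mulr0 addr0.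
  apply: rho_inj; rewrite !rmorphM rmorph_nat rmorphD rmorph1 !rho_mon /fcoord /=.
  by have n2 := nat0 1; field; rewrite n2 x0.
have E12 : E (mon i1 i2) = 0.
  apply: (cancel 0%N _ (mon i0 i1 * mon i0 i2)).
    by rewrite (derivationM derE) E01 E02 mul0r mulr0 addr0.
  by apply: rho_inj; rewrite mul1r !rmorphM !rho_mon; ring.
have E22 : E (mon i2 i2) = 0.
  apply: (cancel 0%N _ (mon i0 i2 * mon i0 i2)).
    by rewrite (derivationM derE) E02 mul0r mulr0 addr0.
  by apply: rho_inj; rewrite mul1r !rmorphM !rho_mon; ring.
have ET : E T = 0.
  apply: (cancel 14%N _ (3 * (mon i0 i1 * mon i2 i2) + 2 * mon i1 i2)).
    rewrite (derivationD derE) !(derivation_natM derE) (derivationM derE).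
    by rewrite E01 E22 E12 mul0r !mulr0 !addr0 mulr0.
  apply: rho_inj; rewrite !(rmorphD, rmorphM, rmorph_nat) rho_T !rho_mon /ft /fcoord /=.
  by have n2 := nat0 1; have n60 := nat0 59; field; rewrite n2 n60 x0.
move=> a; apply/eqP; move: a; apply: (generated (kernel_derivation_subalg derE)).
  move=> i j; rewrite inE.
  wlog le : i j / (i <= j)%N.
    by move=> H; case/orP: (leq_total i j) => le; [|rewrite mon_sym]; exact: H.
  by move: i j le; elim/ord3P; elim/ord3P => //= _; apply/eqP.
by rewrite inE; apply/eqP.
Qed.

(** Two locally nilpotent derivations kill the same transcendental element, hence
are proportional over the function field, hence have the same kernel. *)
Lemma locally_nilpotent_same_kernel (D D' : A -> A) :
    derivation D -> locally_nilpotent D -> derivation D' -> locally_nilpotent D' ->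
  forall a, D a = 0 -> D' a != 0 -> forall b, D b = 0.
Proof.
move=> derD nilD derD' nilD' a Da D'a.
pose E b := D (mon i1 i1) * D' b - D' (mon i1 i1) * D b.
have derE : derivation E.
  split=> [c u v|u v]; rewrite /E.
    rewrite (derivationP derD) (derivationP derD') !mulrDr -!scalerAr scalerBr.
    by rewrite opprD addrACA.
  by rewrite (derivationM derD) (derivationM derD'); ring.
have D00 := locally_nilpotent_kills_mon00 derD nilD.
have D'00 := locally_nilpotent_kills_mon00 derD' nilD'.
have Ea : E a = 0.
  apply: (derivation_eq0 derE); first by rewrite /E D00 D'00 !mulr0 subr0.
  by rewrite /E mulrC subrr.
apply: (derivation_eq0 derD D00).
by move: Ea; rewrite /E Da mulr0 subr0 mulrC => /mulA_eq0; apply.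
Qed.
End Grading.

(** * The two surfaces are not isomorphic *)

(** The kernel of [x2 -> x1 -> x0 -> 0] contains [x0 ^ 2], that of
[x0 -> x1 -> x2 -> 0] does not: on [quadratic k] the kernels of locally nilpotent
derivations are not all equal. *)
Lemma not_isomorphic_Rtilde (k : closedFieldType) : [pchar k] =i pred0 ->
  ~ alg_isomorphic (quadratic k) (Rtilde k).
Proof.
move=> char0 [f [g fK gK]].
pose iota : {rmorphism {poly {poly k}} -> {fraction {poly {poly k}}}} := @tofrac _.
have iota_inj : injective iota by move=> q r /eqP; rewrite tofrac_eq => /eqP.
have [rho [rhoI rhoC rhom rhoT]] := Rtilde_embedding char0 iota_inj.
have transport D : derivation D -> locally_nilpotent D ->
    derivation (f \o D \o g) /\ locally_nilpotent (f \o D \o g).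
  move=> derD nilD; split; last first.
    move=> a; have [n e] := nilD (g a); exists n.
    suff -> : iter n (f \o D \o g) a = f (iter n D (g a)) by rewrite e rmorph0.
    by elim: n {e} => [|n IH] /=; rewrite ?gK // IH /= fK.
  split=> [c|] a b /=; rewrite -[a]gK -[b]gK.
    by rewrite -linearP !fK (derivationP derD) linearP.
  by rewrite -rmorphM !fK (derivationM derD) rmorphD !rmorphM.
have [D [derD nilD [D00 _ D11 _ _]]] := quadratic_down char0.
have [D' [derD' nilD' D'00]] := quadratic_up char0.
have [derfD nilfD] := transport D derD nilD.
have [derfD' nilfD'] := transport D' derD' nilD'.
have nz : 2 * xmon k i0 i1 != 0.
  apply/eqP => /(congr1 (fun z => rho (Rt_const k z)))/eqP.
  rewrite !rmorph0 !rmorphM !rmorph_nat -[Rt_const k _]/(Rt_mon k i0 i1) rhom.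
  by rewrite !mulf_eq0 (negPf (fnat_neq0 char0 iota 1))
    (negPf (fx_neq0 iota_inj)) (negPf (fy_neq0 iota_inj)).
have := locally_nilpotent_same_kernel char0 iota_inj rhoI rhoC rhom rhoT
  (@Rtilde_ind k) derfD nilfD derfD' nilfD' (a := f (xmon k i0 i0)).
rewrite /= fK D00 rmorph0 D'00 => /(_ erefl).
have -> : f (2 * xmon k i0 i1) != 0 by rewrite -(inj_eq (can_inj fK)) ?rmorph0 in nz *.
move=> /(_ isT (f (xmon k i1 i1))) /=; rewrite fK D11 -(rmorph0 f) => /(can_inj fK)/eqP.
by rewrite (negPf nz).
Qed.

Theorem theorem5p3 (k : closedFieldType) (char0 : [pchar k] =i pred0) :
  alg_isomorphic (polyalg (OX k)) (polyalg (Rtilde k)) /\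
  ~ alg_isomorphic (OX k) (Rtilde k).
Proof.
have iso := QuadraticOX.isomorphic char0; split.
  apply: alg_isomorphic_trans (quadratic_cylinder char0).
  exact/alg_isomorphic_polyalg/alg_isomorphic_sym.
by move=> /(alg_isomorphic_trans iso); exact: not_isomorphic_Rtilde.
Qed.
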